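(* Let $(G,C)$ be a class formation ($G$ profinite) and let $H$ be an open normal subgroup of $G$. For any prodiscrete $\mathbf{Z}[G/H]$-module $A$: (1) The complex $\tau_{\le 1}C^*(H,A)$ is isomorphic to $$\mathrm{Hom}(\mathbf{Z}[G/H],A)\to\mathrm{Hom}_{\mathrm{cts}}(E(G/H),A).$$ (2) The complex $\tau_{\le 1}C^*(G,A)$ is isomorphic to $$\mathrm{Hom}_{\mathbf{Z}[G/H]}(\mathbf{Z}[G/H],A)\to\mathrm{Hom}_{\mathbf{Z}[G/H],\mathrm{cts}}(E(G/H),A).$$ (3) The inhomogeneous 1-cocycle $\mathbf{Z}[G]\to E(G/H)$ corresponding to the universal element $\kappa_{\mathrm{univ}}\in Z^1(G,E(G/H))$ is surjective.
   Context: A class module for a finite group $\Gamma$ is a $\Gamma$-module $M$ with $H^1(\Delta,M)=0$ and $H^2(\Delta,M)$ cyclic of order $\#\Delta$ for all subgroups $\Delta\subset\Gamma$; a fundamental class is a generator of $H^2(\Gamma,M)$. A class formation $(G,C)$ consists of a profinite group $G$ and a discrete $G$-module $C$ such that for all open subgroups $H'\subset H$ of $G$ with $H'$ normal in $H$, $C^{H'}$ is a class module for $H/H'$ with a chosen fundamental class $\gamma_{H/H'}\in H^2(H/H',C^{H'})$, these being compatible under restriction and inflation: $\mathrm{res}(\gamma_{H/H'})=\gamma_{H_1/H'}$ for $H'\subset H_1\subset H$, and $\inf(\gamma_{H/H'})=[H':H'']\gamma_{H/H''}$ for $H''\subset H'$ both normal in $H$. For an open normal subgroup $H$ of $G$ the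 class $\gamma_{G/H}$ is represented by an exact sequence of $\mathbf{Z}[G/H]$-modules $0\to C^H\to C(G/H)\to\mathbf{Z}[G/H]\to\mathbf{Z}\to 0$ (last map the augmentation). The reciprocity map $\mathrm{rec}\colon C^H\to H^{\mathrm{ab}}$ is the inverse limit over open normal $H'\subset H$ of the maps $C^H\to C^H/N_{H/H'}(C^{H'})\cong(H/H')^{\mathrm{ab}}$, where the isomorphism is the inverse of the Nakayama map $(H/H')^{\mathrm{ab}}=\widehat H^{-2}(H/H',\mathbf{Z})\to\widehat H^0(H/H',C^{H'})$ given by cup product with $\gamma_{H/H'}$; here $H^{\mathrm{ab}}$ is the profinite abelianization. $E(G/H)$ is the pushout of $C(G/H)$ along $\mathrm{rec}$, so there is an exact sequence $0\to H^{\mathrm{ab}}\to E(G/H)\to\mathbf{Z}[G/H]\to\mathbf{Z}\to 0$; $E(G/H)$ is topologized using the profinite topology on $H^{\mathrm{ab}}$ and the discrete topology on $\mathbf{Z}[G/H]$, and is prodiscrete. A prodiscrete module is an inverse limit of discrete modules with surjective transition maps. $C^i(H,A)$ (resp. $C^i(G,A)$) is the group of continuous $H$-equivariant (resp. $G$-equivariant) maps $G^{i+1}\to A$ with the usual homogeneous coboundary maps; these complexes compute continuous cohomology of $H$ (resp. $G$), and the first is a complex of $G/H$-modules. $\tau_{\le 1}C^*(\cdot,A)$ is the two-term complex $C^0(\cdot,A)\to Z^1(\cdot,A)$, with $Z^1$ the 1-cocycles. The universal element $\kappa_{\mathrm{univ}}$ is the cocycle corresponding under (2), with $A=E(G/H)$,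 to the identity of $E(G/H)$; the map $\mathbf{Z}[G]\to E(G/H)$ is the $\mathbf{Z}$-linear extension of the inhomogeneous cocycle $G\to E(G/H)$. *)

(* Defs.v *)
From HB Require Import structures.
From mathcomp Require Import all_boot all_order all_algebra all_classical.
From mathcomp Require Import topology tvs.
From mathcomp Require Import freeg.

Set Implicit Arguments.
Unset Strict Implicit.
Unset Printing Implicit Defensive.

Import GRing.Theory.
Local Open Scope classical_set_scope.
Local Open Scope ring_scope.

HB.mixin Record isTopologicalGroup G of Group G & Topological G := {
  mulg_continuous : continuous (fun x : G * G => (x.1 * x.2)%g);
  invg_continuous : continuous (fun x : G => x^-1%g)
}.

#[short(type="topGroupType")]
HB.structure Definition TopologicalGroup :=
  {G of Group G & Topological G & isTopologicalGroup G}.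

Definition profinite (G : topGroupType) : Prop :=
  [/\ compact [set: G], hausdorff_space G & totally_disconnected [set: G]].

Record subgroup (G : groupType) (H : set G) : Prop := Subgroup {
  subgroup1 : H 1%g;
  subgroupM : forall x y, H x -> H y -> H (x * y)%g;
  subgroupV : forall x, H x -> H x^-1%g
}.

(* A pair of subgroups [bot] <= [top] with [bot] normal in [top]. *)
Record section (G : groupType) := Section {
  top : set G;
  bot : set G;
  top_subgroup : subgroup top;
  bot_subgroup : subgroup bot;
  bot_sub_top : bot `<=` top;
  bot_normal : forall k n, top k -> bot n -> bot (k * n * k^-1)%g
}.

Definition lcoset (G : groupType) (N : set G) (g : G) : set G :=
  [set (g * n)%g | n in N].

(* The group top/bot: its elements are the cosets g bot with g in top. *)
Record quot (G : groupType) (s : section G) := Quot {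
  qset : set G;
  qsetP : exists2 g, top s g & qset = lcoset (bot s) g
}.

HB.instance Definition _ G (s : section G) := gen_eqMixin (quot s).
HB.instance Definition _ G (s : section G) := gen_choiceMixin (quot s).

Section QuotientGroup.
Variables (G : groupType) (s : section G).

Lemma cls_proof (g : G) :
  exists2 k, top s k &
    lcoset (bot s) (if `[< top s g >] then g else 1%g) = lcoset (bot s) k.
Proof.
case: asboolP => [tg|_]; first by exists g.
by exists 1%g => //; apply: subgroup1 (top_subgroup s).
Qed.

(* The class of g in top/bot; junk value 1 if g is not in top. *)
Definition cls (g : G) : quot s := Quot (cls_proof g).

Definition qrepr (x : quot s) : G := s2val (cid2 (qsetP x)).

Lemma qrepr_top x : top s (qrepr x).
Proof. exact: s2valP (cid2 (qsetP x)). Qed.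

Lemma quot_inj (x y : quot s) : qset x = qset y -> x = y.
Proof.
case: x y => [X PX] [Y PY] /= eXY; subst Y.
by rewrite (Prop_irrelevance PX PY).
Qed.

Lemma qreprK : cancel qrepr cls.
Proof.
move=> x; apply: quot_inj => /=; rewrite asboolT; last exact: qrepr_top.
by rewrite -(s2valP' (cid2 (qsetP x))).
Qed.

Lemma lcoset_eq (g h : G) :
  bot s (g^-1 * h)%g -> lcoset (bot s) g = lcoset (bot s) h.
Proof.
move=> bgh; have B := bot_subgroup s; apply/seteqP; split=> _ [n bn <-].
  exists ((g^-1 * h)^-1 * n)%g; last by rewrite invgM invgK !mulgA mulgV mul1g.
  by apply: subgroupM => //; apply: subgroupV.
exists (g^-1 * h * n)%g; first exact: subgroupM.
by rewrite !mulgA mulgV mul1g.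
Qed.

Lemma cls_eqP (g h : G) : top s g -> top s h ->
  cls g = cls h <-> bot s (g^-1 * h)%g.
Proof.
move=> tg th; split=> [/(congr1 (@qset _ _)) /= |bgh].
  rewrite !asboolT // => egh.
  have [n bn <-] : lcoset (bot s) g h.
    rewrite egh; exists 1%g; last by rewrite mulg1.
    exact: subgroup1 (bot_subgroup s).
  by rewrite mulgA mulVg mul1g.
by apply: quot_inj => /=; rewrite !asboolT //; apply: lcoset_eq.
Qed.

Lemma qrepr_cls g : top s g -> bot s (g^-1 * qrepr (cls g))%g.
Proof. by move=> tg; apply/cls_eqP => //; [exact: qrepr_top|rewrite qreprK]. Qed.

Definition qone : quot s := cls 1%g.
Definition qinv (x : quot s) : quot s := cls (qrepr x)^-1%g.
Definition qmul (x y : quot s) : quot s := cls (qrepr x * qrepr y)%g.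

Let T := top_subgroup s.
Let B := bot_subgroup s.

Lemma qmul_cls g h : top s g -> top s h -> qmul (cls g) (cls h) = cls (g * h)%g.
Proof.
move=> tg th; apply/esym/cls_eqP.
- exact: subgroupM.
- by apply: subgroupM => //; apply: qrepr_top.
set g' := qrepr _; set h' := qrepr _.
have -> : ((g * h)^-1 * (g' * h') =
           h^-1 * (g^-1 * g') * h^-1^-1 * (h^-1 * h'))%g.
  by rewrite invgM invgK !mulgA mulgK.
apply: subgroupM => //; last exact: qrepr_cls.
apply: bot_normal; [exact: subgroupV|exact: qrepr_cls].
Qed.

Lemma qinv_cls g : top s g -> qinv (cls g) = cls g^-1%g.
Proof.
move=> tg; apply/cls_eqP.
- by apply: subgroupV => //; apply: qrepr_top.
- exact: subgroupV.
have tg' : top s (qrepr (cls g)) by exact: qrepr_top.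
set g' := qrepr _ in tg' *; rewrite invgK.
have -> : (g' * g^-1 = (g * (g^-1 * g')^-1 * g^-1)^-1)%g.
  by rewrite !invgM !invgK !mulgA mulgV mul1g.
apply: subgroupV => //; apply: bot_normal => //.
by apply: subgroupV => //; apply: qrepr_cls.
Qed.

Lemma quotE x : exists2 g, top s g & x = cls g.
Proof. by exists (qrepr x); rewrite ?qreprK //; apply: qrepr_top. Qed.

Let t1 : top s 1%g := subgroup1 T.
Let tM := subgroupM T.
Let tV := subgroupV T.

Lemma qmulA : associative qmul.
Proof.
move=> x y z; have [g tg ->] := quotE x; have [h th ->] := quotE y.
have [k tk ->] := quotE z.
by rewrite !qmul_cls ?mulgA //; apply: tM.
Qed.

Lemma qmul1 : left_id qone qmul.
Proof. by move=> x; have [g tg ->] := quotE x; rewrite qmul_cls ?mul1g. Qed.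

Lemma qmulr1 : right_id qone qmul.
Proof. by move=> x; have [g tg ->] := quotE x; rewrite qmul_cls ?mulg1. Qed.

Lemma qmulV : left_inverse qone qinv qmul.
Proof.
move=> x; have [g tg ->] := quotE x.
by rewrite qinv_cls // qmul_cls ?mulVg //; apply: tV.
Qed.

Lemma qmulrV : right_inverse qone qinv qmul.
Proof.
move=> x; have [g tg ->] := quotE x.
by rewrite qinv_cls // qmul_cls ?mulgV //; apply: tV.
Qed.

HB.instance Definition _ :=
  isGroup.Build (quot s) qmulA qmul1 qmulr1 qmulV qmulrV.

Lemma clsM g h : top s g -> top s h -> cls (g * h)%g = (cls g * cls h)%g.
Proof. by move=> tg th; rewrite -qmul_cls. Qed.

Lemma cls1 : cls 1%g = 1%g.
Proof. by []. Qed.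

End QuotientGroup.

(* The homomorphism top s'/bot s' -> top s/bot s induced by the identity of G;
   meant for top s' <= top s and bot s' <= bot s.  It is the inclusion
   H_1/H' -> H/H' or the projection H/H'' -> H/H' in the two cases used. *)
Definition quot_map (G : groupType) (s' s : section G) (x : quot s') : quot s :=
  cls s (qrepr x).

Definition open_section (G : topGroupType) (s : section G) : Prop :=
  open (top s) /\ open (bot s).

Record open_normal (G : topGroupType) := OpenNormal {
  onset :> set G;
  onset_open : open onset;
  onset_subgroup : subgroup onset;
  onset_normal : forall g h, onset h -> onset (g * h * g^-1)%g
}.

Lemma subgroup_setT (G : groupType) : subgroup [set: G].
Proof. by []. Qed.

Definition full_section (G : topGroupType) (H : open_normal G) : section G :=
  @Section G setT H (@subgroup_setT G) (onset_subgroup H) (@subsetT _ _)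
    (fun g h _ Hh => onset_normal g Hh).

(* The closed subgroup generated by the commutators of elements of H. *)
Definition closed_derived (G : topGroupType) (H : set G) : set G :=
  [set x | forall N : set G, closed N -> subgroup N ->
     (forall h k, H h -> H k -> N [~ h, k]%g) -> N x].

Section Abelianization.
Variables (G : topGroupType) (H : open_normal G).

Lemma mulgr_continuous (g : G) : continuous (fun x : G => x * g)%g.
Proof.
move=> x; apply: (@continuous_comp _ _ _ (fun x : G => (x, g))
  (fun x : G * G => (x.1 * x.2)%g)); last exact: mulg_continuous.
by apply: cvg_pair; [exact: cvg_id|exact: cvg_cst].
Qed.

Lemma mulgl_continuous (g : G) : continuous (fun x : G => g * x)%g.
Proof.
move=> x; apply: (@continuous_comp _ _ _ (fun x : G => (g, x))
  (fun x : G * G => (x.1 * x.2)%g)); last exact: mulg_continuous.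
by apply: cvg_pair; [exact: cvg_cst|exact: cvg_id].
Qed.

Lemma open_subgroup_closed (K : set G) : subgroup K -> open K -> closed K.
Proof.
move=> sK oK; rewrite -openC.
have -> : ~` K = \bigcup_(g in ~` K) ((fun x : G => g^-1 * x)%g @^-1` K).
  apply/seteqP; split=> [g nKg|x [g nKg Kgx] Kx].
    by exists g => //=; rewrite mulVg; apply: subgroup1.
  apply: nKg; have -> : g = (x * (g^-1 * x)^-1)%g.
    by rewrite invgM invgK mulgA mulgV mul1g.
  by apply: subgroupM => //; apply: subgroupV.
apply: bigcup_open => g _; apply: open_comp => // x _.
exact: mulgl_continuous.
Qed.

Lemma closed_derived_subgroup : subgroup (closed_derived H).
Proof.
split=> [N _ sN _|x y Dx Dy N cN sN NH|x Dx N cN sN NH].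
- exact: subgroup1.
- by apply: subgroupM => //; [apply: Dx|apply: Dy].
- by apply: subgroupV => //; apply: Dx.
Qed.

Lemma closed_derived_sub : closed_derived H `<=` H.
Proof.
have sH := onset_subgroup H.
move=> x Dx; apply: Dx => //.
  exact: open_subgroup_closed (onset_open H).
move=> h k Hh Hk; rewrite /commg /conjg.
by do ![apply: subgroupM => //|apply: subgroupV => //].
Qed.

Lemma conjg_commg (g h k : G) :
  (g * [~ h, k] * g^-1 = [~ g * h * g^-1, g * k * g^-1])%g.
Proof. by rewrite /commg /conjg !invgM !invgK !mulgA !mulgVK. Qed.

Lemma closed_derived_normal g x :
  closed_derived H x -> closed_derived H (g * x * g^-1)%g.
Proof.
move=> Dx N cN sN NH.
have := Dx ((fun x => g * x * g^-1)%g @^-1` N); apply.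
- apply: closed_comp => // y _.
  apply: (@continuous_comp _ _ _ (fun x : G => g * x)%g (fun x : G => x * g^-1)%g).
    exact: mulgl_continuous.
  exact: mulgr_continuous.
- split=> [|y z /= Ny Nz|y /= Ny].
  + by rewrite /= mulg1 mulgV; apply: subgroup1.
  + have -> : (g * (y * z) * g^-1 = (g * y * g^-1) * (g * z * g^-1))%g.
      by rewrite !mulgA mulgVK.
    exact: subgroupM.
  + have -> : (g * y^-1 * g^-1 = (g * y * g^-1)^-1)%g.
      by rewrite !invgM invgK mulgA.
    exact: subgroupV.
move=> h k Hh Hk /=; rewrite conjg_commg; apply: NH; exact: onset_normal.
Qed.

Definition ab_section : section G :=
  @Section G H (closed_derived H) (onset_subgroup H) closed_derived_subgroup
    closed_derived_sub (fun g x _ Dx => closed_derived_normal g Dx).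

Definition profinite_ab := quot ab_section.

Definition ab_class (h : G) : profinite_ab := cls ab_section h.

(* Open sets for the profinite, i.e. quotient, topology of H^ab. *)
Definition ab_open (V : set profinite_ab) : Prop :=
  open [set h : G | onset H h /\ V (ab_class h)].

End Abelianization.

Record gmod (Gam : groupType) := Gmod {
  gsort :> zmodType;
  act : Gam -> gsort -> gsort;
  act1 : forall x, act 1%g x = x;
  actM : forall g h x, act (g * h)%g x = act g (act h x);
  actD : forall g x y, act g (x + y) = act g x + act g y
}.

Definition is_additive (M N : zmodType) (f : M -> N) : Prop :=
  forall x y, f (x + y) = f x + f y.

Definition is_equivariant (Gam : groupType) (M N : gmod Gam) (f : M -> N) : Prop :=
  forall g x, f (act g x) = act g (f x).

Definition is_ghom (Gam : groupType) (M N : gmod Gam) (f : M -> N) : Prop :=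
  is_additive f /\ is_equivariant f.

(* Topological modules, for the discrete topology on the group. *)
Record tmod (Gam : groupType) := Tmod {
  tsort :> topologicalZmodType;
  tact : Gam -> tsort -> tsort;
  tact1 : forall x, tact 1%g x = x;
  tactM : forall g h x, tact (g * h)%g x = tact g (tact h x);
  tactD : forall g x y, tact g (x + y) = tact g x + tact g y;
  tact_continuous : forall g, continuous (tact g)
}.

Definition gmod_of_tmod (Gam : groupType) (A : tmod Gam) : gmod Gam :=
  Gmod (@tact1 _ A) (@tactM _ A) (@tactD _ A).

Record inverse_system (Gam : groupType) := InverseSystem {
  idx : Type;
  idx_le : idx -> idx -> Prop;
  idx_refl : forall i, idx_le i i;
  idx_trans : forall i j k, idx_le i j -> idx_le j k -> idx_le i k;
  idx_inhabited : inhabited idx;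
  idx_directed : forall i j, exists k, idx_le i k /\ idx_le j k;
  obj : idx -> gmod Gam;
  trans : forall i j, idx_le i j -> obj j -> obj i;
  trans_hom : forall i j (h : idx_le i j), is_ghom (trans h);
  trans_id : forall i (h : idx_le i i) x, trans h x = x;
  trans_comp : forall i j k (hij : idx_le i j) (hjk : idx_le j k)
    (hik : idx_le i k) x, trans hij (trans hjk x) = trans hik x;
  trans_surj : forall i j (h : idx_le i j) y, exists x, trans h x = y
}.

(* [A] is the inverse limit of the system [S] of discrete modules along the
   projections [pr]: since [S] is directed, the fibres of the [pr i] form a base
   of neighbourhoods for the limit topology. *)
Definition is_inverse_limit (Gam : groupType) (A : tmod Gam)
    (S : inverse_system Gam) (pr : forall i : idx S, A -> obj i) : Prop :=
  [/\ forall i, is_ghom (pr i : gmod_of_tmod A -> obj i),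
      forall i j (h : idx_le i j) a, trans h (pr j a) = pr i a,
      forall y : (forall i : idx S, obj i),
        (forall i j (h : idx_le i j), trans h (y j) = y i) ->
        exists! a : A, forall i, pr i a = y i
    & forall (a : A) (U : set A),
        nbhs a U <-> exists i, forall b, pr i b = pr i a -> U b].

Definition prodiscrete (Gam : groupType) (A : tmod Gam) : Prop :=
  exists (S : inverse_system Gam) (pr : forall i : idx S, A -> obj i),
    is_inverse_limit pr.

Record fixpts (G : groupType) (C : gmod G) (N : set G) := Fixpts {
  fixval :> C;
  _ : `[< forall n, N n -> act n fixval = fixval >]
}.

HB.instance Definition _ G (C : gmod G) N := [isSub for @fixval G C N].
HB.instance Definition _ G (C : gmod G) N := [Choice of fixpts C N by <:].

Lemma act0 (G : groupType) (C : gmod G) g : act g (0 : C) = 0.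
Proof. by apply: (addIr (act g 0)); rewrite -actD !add0r. Qed.

Lemma actN (G : groupType) (C : gmod G) g (x : C) : act g (- x) = - act g x.
Proof. by apply: (addIr (act g x)); rewrite -actD !addNr act0. Qed.

Lemma fixpts_zmod_closed (G : groupType) (C : gmod G) (N : set G) :
  zmod_closed (fun c : C => `[< forall n, N n -> act n c = c >]).
Proof.
split=> [|x y /asboolP Nx /asboolP Ny]; apply/asboolP => n Nn.
  exact: act0.
by rewrite actD actN Nx // Ny.
Qed.

HB.instance Definition _ G (C : gmod G) N :=
  GRing.SubChoice_isSubZmodule.Build C _ (fixpts C N) (@fixpts_zmod_closed G C N).

Lemma fixptsP (G : groupType) (C : gmod G) N (c : fixpts C N) n :
  N n -> act n (fixval c) = c.
Proof. by case: c => c /= /asboolP; apply. Qed.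

Lemma fix_incl_proof (G : groupType) (C : gmod G) (N' N : set G)
  (h : N' `<=` N) (c : fixpts C N) :
  `[< forall n, N' n -> act n (fixval c) = c >].
Proof. by apply/asboolP => n /h; apply: fixptsP. Qed.

Definition fix_incl (G : groupType) (C : gmod G) (N' N : set G)
  (h : N' `<=` N) (c : fixpts C N) : fixpts C N' := Fixpts (fix_incl_proof h c).

(* C^bot as a module over top/bot. *)
Section FixedModule.
Variables (G : groupType) (C : gmod G) (s : section G).

Lemma fix_act_proof (x : quot s) (c : fixpts C (bot s)) :
  `[< forall n, bot s n -> act n (act (qrepr x) c) = act (qrepr x) c >].
Proof.
apply/asboolP => n bn; rewrite -actM.
have -> : (n * qrepr x = qrepr x * ((qrepr x)^-1 * n * (qrepr x)^-1^-1))%g.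
  by rewrite invgK !mulgA mulgV mul1g.
rewrite actM fixptsP //; apply: bot_normal => //.
by apply: subgroupV (top_subgroup s) _ _; apply: qrepr_top.
Qed.

Definition fix_act (x : quot s) (c : fixpts C (bot s)) : fixpts C (bot s) :=
  Fixpts (fix_act_proof x c).

Lemma fix_act_cls g (c : fixpts C (bot s)) :
  top s g -> fixval (fix_act (cls s g) c) = act g c.
Proof.
move=> tg /=; have := qrepr_cls tg; set r := qrepr _ => br.
by rewrite -{1}(mulKg g^-1 r)%g invgK actM fixptsP.
Qed.

Lemma fix_act1 c : fix_act 1%g c = c.
Proof.
apply/val_inj/(etrans (fix_act_cls _ _)); last exact: act1.
exact: subgroup1 (top_subgroup s).
Qed.

Lemma fix_actM x y c : fix_act (x * y)%g c = fix_act x (fix_act y c).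
Proof.
have [g tg ->] := quotE x; have [h th ->] := quotE y.
rewrite -clsM //; apply/val_inj.
rewrite [LHS]fix_act_cls; last exact: subgroupM (top_subgroup s) _ _ _ _.
by rewrite [RHS]fix_act_cls // fix_act_cls // actM.
Qed.

Lemma fix_actD x c d : fix_act x (c + d) = fix_act x c + fix_act x d.
Proof. by apply/val_inj; rewrite /= actD. Qed.

Definition fixmod : gmod (quot s) := Gmod fix_act1 fix_actM fix_actD.

End FixedModule.

(* A module over G/H, regarded as a module over G. *)
Section Inflation.
Variables (G : topGroupType) (H : open_normal G) (M : gmod (quot (full_section H))).

Definition infl_act (g : G) (x : M) : M := act (cls _ g) x.

Lemma infl_act1 x : infl_act 1%g x = x.
Proof. by rewrite /infl_act cls1 act1. Qed.

Lemma infl_actM g h x : infl_act (g * h)%g x = infl_act g (infl_act h x).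
Proof. by rewrite /infl_act clsM // actM. Qed.

Lemma infl_actD g x y : infl_act g (x + y) = infl_act g x + infl_act g y.
Proof. exact: actD. Qed.

Definition inflmod : gmod G := Gmod infl_act1 infl_actM infl_actD.

End Inflation.

(* The Z-linear extension Z[T] -> M of a map T -> M. *)
Definition zlin (T : choiceType) (M : zmodType) (f : T -> M) (z : {freeg T}) : M :=
  fglift (f : T -> zmodule M) z.

Lemma zlinD (T : choiceType) (M : zmodType) (f : T -> M) : is_additive (zlin f).
Proof.
move=> x y; have A : forall x y, zlin f (x - y) = zlin f x - zlin f y :=
  @lift_is_additive int T (zmodule M) f.
have E0 : zlin f 0 = 0 by have := A 0 0; rewrite !subr0 subrr.
have EN z : zlin f (- z) = - zlin f z by have := A 0 z; rewrite !sub0r E0 sub0r.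
by have := A x (- y); rewrite opprK EN opprK.
Qed.

Lemma zlinU (T : choiceType) (M : zmodType) (f : T -> M) k t :
  zlin f << k *g t >> = f t *~ k.
Proof. exact: (@liftU int (zmodule M) T f k t). Qed.

Lemma zadd_ext (T : choiceType) (M : zmodType) (f g : {freeg T} -> M) :
  is_additive f -> is_additive g ->
  (forall k t, f << k *g t >> = g << k *g t >>) -> f =1 g.
Proof.
move=> fD gD fg z.
have f0 (h : {freeg T} -> M) : is_additive h -> h 0 = 0.
  by move=> hD; apply: (addIr (h 0)); rewrite -hD !add0r.
rewrite -[z]freeg_sumE; elim/big_rec: _ => [|i x _ IH]; first by rewrite !f0.
by rewrite fD gD IH fg.
Qed.

Section GroupRing.
Variable Gam : groupType.

(* Left multiplication by g on Z[Gam]. *)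
Definition zact (g : Gam) (z : {freeg Gam}) : {freeg Gam} :=
  zlin (fun h : Gam => << (g * h)%g >>) z.

Lemma zactD g : is_additive (zact g).
Proof. exact: zlinD. Qed.

Lemma zactU g k h : zact g << k *g h >> = << k *g (g * h)%g >>.
Proof. by rewrite /zact zlinU freegU_mulz intz. Qed.

Lemma zact1 z : zact 1%g z = z.
Proof.
have Iadd : is_additive (fun y : {freeg Gam} => y) by [].
by apply: (zadd_ext (zactD 1%g) Iadd) => k h; rewrite zactU mul1g.
Qed.

Lemma zactM g h z : zact (g * h)%g z = zact g (zact h z).
Proof.
have Cadd : is_additive (zact g \o zact h).
  by move=> x y /=; rewrite (zactD h) zactD.
by apply: (zadd_ext (zactD (g * h)%g) Cadd) => k x; rewrite /= !zactU mulgA.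
Qed.

Definition zring : gmod Gam := Gmod zact1 zactM zactD.

End GroupRing.

(* For a subset (in practice a subgroup) D of Gam and a Gam-module M, the
   D-equivariant maps Gam^(n+1) -> M form the degree n part of a complex that
   computes H^n(D, M).  This is used both for finite groups and, with continuous
   maps, for profinite ones. *)
Section Cochains.
Variables (Gam : groupType) (M : gmod Gam).

Definition cochain (n : nat) := ('I_n.+1 -> Gam) -> M.

Definition cobd n (f : cochain n) : cochain n.+1 :=
  fun x => \sum_(k < n.+2) f (fun i => x (fintype.lift k i)) *~ (-1) ^+ k.

Definition equivariant (D : set Gam) n (f : cochain n) : Prop :=
  forall d x, D d -> f (fun i => d * x i)%g = act d (f x).

Definition cocycle (D : set Gam) n (f : cochain n) : Prop :=
  equivariant D f /\ forall x, cobd f x = 0.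

Definition coboundary (D : set Gam) n (f : cochain n.+1) : Prop :=
  exists2 e : cochain n, equivariant D e & forall x, f x = cobd e x.

Definition cohomologous (D : set Gam) n (f g : cochain n.+1) : Prop :=
  coboundary D (fun x => f x - g x).

(* The class of f generates H^(n+1)(D, M). *)
Definition generator (D : set Gam) n (f : cochain n.+1) : Prop :=
  cocycle D f /\
  forall g : cochain n.+1, cocycle D g ->
    exists k : int, cohomologous D g (fun x => f x *~ k).

Definition H1_trivial (D : set Gam) : Prop :=
  forall f : cochain 1, cocycle D f -> coboundary D f.

Definition H2_cyclic_of_order (D : set Gam) (m : nat) : Prop :=
  exists2 f : cochain 2, generator D f &
    forall k : int, coboundary D (fun x => f x *~ k) <-> (m%:Z %| k)%Z.

Definition class_module : Prop :=
  forall D : set Gam, subgroup D ->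
    H1_trivial D /\ exists2 m, (D #= `I_m)%card & H2_cyclic_of_order D m.

Definition fundamental_class (f : cochain 2) : Prop := generator setT f.

End Cochains.

(* Pullback of cochains along top s'/bot s' -> top s/bot s and the inclusion
   C^(bot s) -> C^(bot s'): restriction if bot s' = bot s and inflation if
   top s' = top s. *)
Definition pull (G : groupType) (C : gmod G) (s' s : section G)
    (h : bot s' `<=` bot s) n (f : cochain (fixmod C s) n) :
    cochain (fixmod C s') n :=
  fun x => fix_incl h (f (fun i => quot_map s (x i))).

(* [K : N] = m *)
Definition has_index (G : groupType) (K N : set G) (m : nat) : Prop :=
  ([set lcoset N k | k in K] #= `I_m)%card.

Record class_formation (G : topGroupType) := ClassFormation {
  cf_mod :> gmod G;
  cf_discrete : forall c : cf_mod, open [set g : G | act g c = c];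
  cf_class_module : forall s : section G, open_section s ->
    class_module (fixmod cf_mod s);
  (* a cocycle representing the chosen fundamental class; only its values at
     open sections matter *)
  fund : forall s : section G, cochain (fixmod cf_mod s) 2;
  fundP : forall s : section G, open_section s -> fundamental_class (@fund s);
  fund_res : forall (s1 s : section G) (h : bot s1 `<=` bot s),
    open_section s1 -> open_section s ->
    top s1 `<=` top s -> bot s1 = bot s ->
    cohomologous setT (pull h (@fund s)) (@fund s1);
  fund_inf : forall (s2 s : section G) (h : bot s2 `<=` bot s) (m : nat),
    open_section s2 -> open_section s ->
    top s2 = top s -> has_index (bot s) (bot s2) m ->
    cohomologous setT (pull h (@fund s)) (fun x => @fund s2 x *+ m)
}.

Arguments fund {G} _ s _.

Section Nakayama.
Variables (Gam : groupType) (M : gmod Gam).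

(* Tate cochains of degree -2 with values in Z are the Gam-invariant maps
   Gam^2 -> Z (Hom_Gam(P_(-2), Z), where P_(-2) is the dual of Z[Gam^2] in the
   standard complete resolution).  The class of sigma under
   Gam^ab = H_1(Gam, Z) = H^(-2)(Gam, Z) is the norm of the standard chain
   (1, sigma). *)
Definition tate_ab (sigma : Gam) (s1 s2 : Gam) : int := (s2 == s1 * sigma)%g%:R.

(* Cup product of a Tate cochain of degree -2 with a 2-cochain, for the diagonal
   approximation P_0 -> P_(-2) (x) P_2 of the standard complete resolution,
   (g) |-> sum_(s1, s2) (s1^*, s2^* ) (x) (s2, s1, g)
   (Atiyah-Wall, Section 7 of Cassels-Frohlich, Chapter IV). *)
Definition tate_cup (a : Gam -> Gam -> int) (f : cochain M 2) : cochain M 0 :=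
  fun x => \sum_(s1 \in [set: Gam]) \sum_(s2 \in [set: Gam])
    f (tnth [tuple s2; s1; x ord0]) *~ a s1 s2.

Definition norm (m : M) : M := \sum_(t \in [set: Gam]) act t m.

(* The invariant element m represents the image of sigma in M^Gam / N(M) under
   the cup product with the class of f. *)
Definition nakayama (f : cochain M 2) (sigma : Gam) (m : M) : Prop :=
  exists b : M, forall x, m = tate_cup (tate_ab sigma) f x + norm b.

End Nakayama.

(* rec is the inverse limit of the maps
   C^H -> C^H/N(C^H') = (H/H')^ab, H' open and normal in H. *)
Definition reciprocity (G : topGroupType) (C : class_formation G)
    (H : open_normal G) (rec : fixpts C H -> profinite_ab H) : Prop :=
  forall (c : fixpts C H) (h : G), onset H h -> rec c = ab_class H h ->
  forall s : section G, open_section s -> top s = H ->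
  forall m : fixmod C s, fixval m = fixval c ->
    nakayama (fund C s) (cls s h) m.

(* An exact sequence 0 -> M -> X -> Z[Gam] -> Z -> 0 representing the class of
   the 2-cocycle f. *)
Record extension2 (Gam : groupType) (M : gmod Gam) (f : cochain M 2) := Extension2 {
  ext_mod :> gmod Gam;
  ext_in : M -> ext_mod;
  ext_out : ext_mod -> zring Gam;
  ext_in_hom : is_ghom ext_in;
  ext_out_hom : is_ghom ext_out;
  ext_in_inj : injective ext_in;
  ext_exact : forall x, ext_out x = 0 <-> exists m, ext_in m = x;
  ext_exact_aug : forall z : zring Gam, deg z = 0 <-> exists x, ext_out x = z;
  (* f is the image of 1 under the two connecting maps
     H^0(Gam, Z) -> H^1(Gam, I) -> H^2(Gam, M) *)
  ext_class : exists (u : cochain (zring Gam) 0) (v : cochain ext_mod 1)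
      (w : cochain M 2),
    [/\ equivariant setT u /\ (forall x, deg (u x) = 1),
        equivariant setT v /\ (forall x, ext_out (v x) = cobd u x),
        forall x, ext_in (w x) = cobd v x
      & cohomologous setT w f]
}.

Section Pushout.
Variables (G : topGroupType) (C : class_formation G) (H : open_normal G).
Let Gam := quot (full_section H).
Variables (X : extension2 (fund C (full_section H))).
Variables (rec : fixpts C H -> profinite_ab H).

(* A commutative square of Z[G/H]-modules from C^H to N through H^ab (with the
   conjugation action) and C(G/H). *)
Record is_cocone (N : gmod Gam) (j : profinite_ab H -> N) (q : X -> N) : Prop :=
  IsCocone {
    cocone_mul : forall a b, j (a * b)%g = j a + j b;
    cocone_conj : forall g h, onset H h ->
      j (ab_class H (g * h * g^-1)%g) = act (cls _ g) (j (ab_class H h));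
    cocone_hom : is_ghom q;
    cocone_comm : forall c, q (ext_in X c) = j (rec c)
  }.

(* E(G/H), with the map to Z[G/H] induced by the one of C(G/H). *)
Record pushout_module := PushoutModule {
  po_mod :> tmod Gam;
  po_ab : profinite_ab H -> po_mod;
  po_ext : X -> po_mod;
  po_out : po_mod -> {freeg Gam};
  po_cocone : @is_cocone (gmod_of_tmod po_mod) po_ab po_ext;
  po_universal : forall (N : gmod Gam) (j : profinite_ab H -> N) (q : X -> N),
    is_cocone j q ->
    exists! f : po_mod -> N,
      [/\ is_ghom (f : gmod_of_tmod po_mod -> N),
          forall a, f (po_ab a) = j a & forall x, f (po_ext x) = q x];
  po_out_hom : is_ghom (po_out : gmod_of_tmod po_mod -> zring Gam);
  po_out_ab : forall a, po_out (po_ab a) = 0;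
  po_out_ext : forall x, po_out (po_ext x) = ext_out x;
  (* H^ab is an open subgroup, with its profinite topology; equivalently
     Z[G/H] is discrete *)
  po_topology : forall V : set (profinite_ab H), open (po_ab @` V) <-> ab_open V
}.

End Pushout.

Arguments po_out {G C H X rec} p _.

Definition group_iso (U V : zmodType) (A : set U) (B : set V) (F : U -> V) : Prop :=
  set_bij A B F /\ (forall x y, A x -> A y -> F (x + y) = F x + F y).

(* F0, F1 is an isomorphism from dA : A0 -> A1 to dB : B0 -> B1. *)
Definition complex_iso (U0 U1 V0 V1 : zmodType) (A0 : set U0) (A1 : set U1)
    (dA : U0 -> U1) (B0 : set V0) (B1 : set V1) (dB : V0 -> V1)
    (F0 : U0 -> V0) (F1 : U1 -> V1) : Prop :=
  [/\ group_iso A0 B0 F0, group_iso A1 B1 F1 &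
      forall f, A0 f -> F1 (dA f) = dB (F0 f)].

Section Complexes.
Variables (G : topGroupType) (H : open_normal G).
Let Gam := quot (full_section H).

Definition Ginfl (A : tmod Gam) : gmod G := inflmod (gmod_of_tmod A).

(* C^n(D, A), for the product topology on G^(n+1) *)
Definition cts_cochains (D : set G) (n : nat) (A : tmod Gam) :
    set (('I_n.+1 -> G) -> A) :=
  [set f | @equivariant G (Ginfl A) D n f /\
           continuous (f : {ptws 'I_n.+1 -> G} -> A)].

Definition coboundary_map (n : nat) (A : tmod Gam) :
    (('I_n.+1 -> G) -> A) -> (('I_n.+2 -> G) -> A) :=
  @cobd G (Ginfl A) n.

(* Z^n(D, A) *)
Definition cts_cocycles (D : set G) (n : nat) (A : tmod Gam) :
    set (('I_n.+1 -> G) -> A) :=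
  [set f | cts_cochains D f /\ forall x, coboundary_map f x = 0].

Definition Hom_Z (M A : tmod Gam) : set (M -> A) :=
  [set f | @is_additive M A f /\ continuous (f : M -> A)].

Definition Hom_G (M A : tmod Gam) : set (M -> A) :=
  [set f | is_ghom (f : gmod_of_tmod M -> gmod_of_tmod A) /\
           continuous (f : M -> A)].

Definition HomZring_Z (A : tmod Gam) : set ({freeg Gam} -> A) :=
  [set f | is_additive f].

Definition HomZring_G (A : tmod Gam) : set ({freeg Gam} -> A) :=
  [set f | is_ghom (f : zring Gam -> gmod_of_tmod A)].

(* The action (g f)(x) = g f(g^-1 x) of G on maps T -> A; it factors through G/H
   on H-equivariant maps, and when the action on T does. *)
Definition conj_act (A : tmod Gam) (T : Type) (t : G -> T -> T) (g : G)
    (f : T -> A) : T -> A :=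
  fun x => @act G (Ginfl A) g (f (t g^-1%g x)).

Definition translate (n : nat) (g : G) (x : 'I_n -> G) : 'I_n -> G :=
  fun i => (g * x i)%g.

(* F is natural in the prodiscrete module A. *)
Definition natural (S T : Type) (D : forall A : tmod Gam, set (S -> A))
    (F : forall A : tmod Gam, (S -> A) -> (T -> A)) : Prop :=
  forall (A B : tmod Gam) (u : A -> B), prodiscrete A -> prodiscrete B ->
    Hom_G u -> forall f, D A f -> F B (u \o f) = u \o F A f.

(* g |-> f(1, g) *)
Definition inhomogeneous (A : tmod Gam) (f : ('I_2 -> G) -> A) (g : G) : A :=
  f (tnth [tuple 1%g; g]).

End Complexes.

Arguments cts_cochains {G H} D n A _.
Arguments cts_cocycles {G H} D n A _.
Arguments coboundary_map {G H} n A _ _.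
Arguments Hom_Z {G H} M A _.
Arguments Hom_G {G H} M A _.
Arguments HomZring_Z {G H} A _.
Arguments HomZring_G {G H} A _.
Arguments translate {G} n g x _.

(* Main.v *)
(* The heart of the matter is a Shafarevich-Weil theorem: E(G/H) carries a
   1-cocycle kap of G that lifts g |-> [g] - 1 and restricts on H to the inverse
   of H -> H^ab.  As kap generates E(G/H), the isomorphisms are composition with
   [<< g >>] in degree 0 and with kap(x1) - kap(x0) in degree 1.

   Constructing kap amounts to finding n : G -> H^ab with boundary the opposite
   of rec_*(a), a representing the fundamental class of G/H, and n(h) = h^-1 on
   H.  Modulo an open normal subgroup U of G, let f represent the fundamental
   class of G/U, let N be the norm of H/U and P(g) = sum_(r in H/U) f(r, g),
   which computes the Nakayama map on H/U.  Since N f is cohomologous to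
   [H:U] f, which is the inflation of a, there is nu with
   d(nu) = N f - inf(a), and H^1(H/U, C^U) = 0 lets us take nu = P on H/U.  Then
   nu has values in C^H and rec(nu) is a solution modulo U.  A solution is
   obtained in the limit by compactness of G^G.

   This uses that the Nakayama map is injective on (H/U)^ab: if P(s) is a norm,
   then its cup product with the Bockstein of a character chi is zero; but this
   is chi(s) times the fundamental class, whence chi(s) = 0. *)
Require Import Defs.
From HB Require Import structures.
From mathcomp Require Import all_boot all_order all_algebra all_classical.
From mathcomp Require Import topology tvs.
From mathcomp Require Import freeg.
From mathcomp Require fingroup commutator cyclic algC cyclotomic.
From mathcomp Require classfun character.

Set Implicit Arguments.
Unset Strict Implicit.
Unset Printing Implicit Defensive.

Import GRing.Theory.
Local Open Scope classical_set_scope.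
Local Open Scope ring_scope.

(** * Linear equations in abelian groups, by reflection *)
Inductive zexpr := ZVar of nat | ZZero | ZAdd of zexpr & zexpr | ZOpp of zexpr.

Fixpoint zeval (M : zmodType) (env : seq M) (e : zexpr) : M :=
  match e with
  | ZVar n => nth 0 env n
  | ZZero => 0
  | ZAdd a b => zeval env a + zeval env b
  | ZOpp a => - zeval env a
  end.

Fixpoint zcoef (e : zexpr) (n : nat) : int :=
  match e with
  | ZVar m => (m == n)%:R
  | ZZero => 0
  | ZAdd a b => zcoef a n + zcoef b n
  | ZOpp a => - zcoef a n
  end.

Fixpoint zbound (e : zexpr) : nat :=
  match e with
  | ZVar n => n.+1
  | ZZero => 0
  | ZAdd a b => maxn (zbound a) (zbound b)
  | ZOpp a => zbound a
  end.

Lemma zevalE (M : zmodType) (env : seq M) e n : (zbound e <= n)%N ->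
  zeval env e = \sum_(i < n) env`_i *~ zcoef e i.
Proof.
elim: e => /= [m mn||a IHa b IHb|a IH].
- rewrite (bigD1 (Ordinal mn)) //= eqxx mulr1z big1 ?addr0 // => i.
  by rewrite -val_eqE eq_sym /= => /negPf ->; rewrite mulr0z.
- by move=> _; rewrite big1 // => i _; rewrite mulr0z.
- rewrite geq_max => /andP[an bn]; rewrite IHa // IHb // -big_split /=.
  by apply: eq_bigr => i _; rewrite mulrzDr.
- by move=> an; rewrite IH // -sumrN; apply: eq_bigr => i _; rewrite mulrNz.
Qed.

(** Both sides are integer combinations of the same atoms, so it suffices to compare coefficients,
    which is a computation on closed terms. *)
Lemma zeval_eq (M : zmodType) (env : seq M) (l r : zexpr) :
  all (fun i => zcoef l i == zcoef r i) (iota 0 (maxn (zbound l) (zbound r))) ->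
  zeval env l = zeval env r.
Proof.
move=> /allP h; set n := maxn _ _ in h.
rewrite (@zevalE _ _ l n) ?leq_maxl // (@zevalE _ _ r n) ?leq_maxr //.
by apply: eq_bigr => i _; rewrite (eqP (h i _)) // mem_iota /=.
Qed.

(** Typing [erefl x] against [x = y] matches atoms up to conversion, not just syntactically. *)
Ltac zenv_index x env :=
  match env with
  | ?y :: _ => let e := constr:(erefl x : x = y) in constr:(0%N)
  | _ :: ?env' => let n := zenv_index x env' in constr:(S n)
  end.

Ltac zenv_add x env :=
  match env with
  | _ => let n := zenv_index x env in env
  | _ => constr:(x :: env)
  end.

Ltac zcollect t env :=
  lazymatch t with
  | (?a + ?b)%R => let env := zcollect a env in zcollect b env
  | (- ?a)%R => zcollect a env
  | 0%R => env
  | _ => zenv_add t env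
  end.

Ltac zreify t env :=
  lazymatch t with
  | (?a + ?b)%R =>
      let a' := zreify a env in let b' := zreify b env in constr:(ZAdd a' b')
  | (- ?a)%R => let a' := zreify a env in constr:(ZOpp a')
  | 0%R => constr:(ZZero)
  | _ => let n := zenv_index t env in constr:(ZVar n)
  end.

Ltac zmod :=
  match goal with |- @eq ?T ?l ?r =>
    let env := zcollect l (@nil T) in
    let env := zcollect r env in
    let l' := zreify l env in
    let r' := zreify r env in
    apply: (@zeval_eq _ env l' r'); vm_compute; reflexivity
  end.

(* [zmod1 h], [zmod2 h h'], ... prove an equation that is a combination of the
   given ones with coefficients [1] and [-1]. *)
Lemma addeq (M : zmodType) (a b l r : M) : a = b -> l + b = r + a -> l = r.
Proof. by move=> ->; apply: addIr. Qed.

Ltac zlc h := apply: (addeq h).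
Ltac zmod1 h := first [zlc h; zmod | zlc (esym h); zmod].
Ltac zmod2 h h' := first [zlc h; zmod1 h' | zlc (esym h); zmod1 h'].
Ltac zmod3 h h' h'' := first [zlc h; zmod2 h' h'' | zlc (esym h); zmod2 h' h''].

(** * Sums over a finite group *)

Lemma is_additive0 (M N : zmodType) (p : M -> N) : is_additive p -> p 0 = 0.
Proof. by move=> pD; apply: (addIr (p 0)); rewrite -pD !add0r. Qed.

Lemma is_additiveN (M N : zmodType) (p : M -> N) : is_additive p ->
  forall x, p (- x) = - p x.
Proof.
by move=> pD x; apply: (addIr (p x)); rewrite -pD !addNr (is_additive0 pD).
Qed.

Lemma is_additiveB (M N : zmodType) (p : M -> N) : is_additive p ->
  forall x y, p (x - y) = p x - p y.
Proof. by move=> pD x y; rewrite pD (is_additiveN pD). Qed.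

Lemma is_additiveMz (M N : zmodType) (p : M -> N) : is_additive p ->
  forall x k, p (x *~ k) = p x *~ k.
Proof.
move=> pD x [n|n]; last rewrite !NegzE !mulrNz (is_additiveN pD); last congr -%R.
all: rewrite -!pmulrn; elim: n => [|n IH]; rewrite ?mulr0n ?(is_additive0 pD) //.
all: by rewrite mulrSr pD IH -mulrSr.
Qed.

Lemma act_additive (Q : groupType) (M : gmod Q) g : is_additive (@act Q M g).
Proof. exact: actD. Qed.

(* Locked, so that comparing two sums never unfolds them. *)
HB.lock Definition gsum (K : groupType) (M : zmodType) (F : K -> M) : M :=
  \sum_(r \in [set: K]) F r.

Section GroupSums.
Variable K : groupType.

Lemma eq_gsum (M : zmodType) (F F' : K -> M) : F =1 F' -> gsum F = gsum F'.
Proof. by move=> /funext ->. Qed.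

Lemma gsum_shiftl (M : zmodType) g (F : K -> M) :
  gsum (fun r => F (g * r)%g) = gsum F.
Proof.
rewrite gsum.unlock [RHS](reindex_fsbigT (fun r => g * r)%g) //.
by exists (fun r => g^-1 * r)%g => r; rewrite mulgA ?mulVg ?mulgV mul1g.
Qed.

Lemma gsum_shiftr (M : zmodType) g (F : K -> M) :
  gsum (fun r => F (r * g)%g) = gsum F.
Proof.
rewrite gsum.unlock [RHS](reindex_fsbigT (fun r => r * g)%g) //.
by exists (fun r => r * g^-1)%g => r; rewrite -mulgA ?mulVg ?mulgV mulg1.
Qed.

Hypothesis finK : finite_set [set: K].

Lemma gsumD (M : zmodType) (F F' : K -> M) :
  gsum (fun r => F r + F' r) = gsum F + gsum F'.
Proof. by rewrite gsum.unlock; apply: fsbig_split. Qed.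

Lemma gsum_additive (M N : zmodType) (p : M -> N) (F : K -> M) :
  is_additive p -> p (gsum F) = gsum (fun r => p (F r)).
Proof.
move=> pD; rewrite !gsum.unlock !fsbig_finite //.
by apply: big_morph => //; apply: is_additive0.
Qed.

Lemma gsumN (M : zmodType) (F : K -> M) : gsum (fun r => - F r) = - gsum F.
Proof. by rewrite (gsum_additive (p := -%R)) // => x y; rewrite opprD. Qed.

Lemma gsum_mulz (M : zmodType) (F : K -> int) (x : M) :
  gsum (fun r => x *~ F r) = x *~ gsum F.
Proof.
by rewrite (gsum_additive (p := fun k => x *~ k)) // => k l; rewrite mulrzDr.
Qed.

Lemma gsum_const (M : zmodType) (x : M) m : ([set: K] #= `I_m)%card ->
  gsum (fun _ : K => x) = x *+ m.
Proof.
move=> /card_set_bijP[g gb]; rewrite gsum.unlock.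
rewrite -(@reindex_fsbig _ _ _ _ nat g setT `I_m (fun=> x) gb).
by rewrite -(fsbig_ord _ _ (fun=> x)) big_const_ord iter_addr_0.
Qed.

End GroupSums.

(** * The Nakayama map of a 2-cocycle *)

Definition cocycle2 (Q : groupType) (M : gmod Q) (f : Q -> Q -> M) : Prop :=
  forall s t r, act s (f t r) + f s (t * r)%g = f (s * t)%g r + f s t.

(** The commutator subgroup, as an intersection of subgroups in parallel with [closed_derived]. *)
Definition derived (K : groupType) (x : K) : Prop :=
  forall S : set K, subgroup S -> (forall h k, S [~ h, k]%g) -> S x.

Section NakayamaRelation.
Variables (K : groupType) (finK : finite_set [set: K]).
Variables (M : gmod K) (f : K -> K -> M) (fE : cocycle2 f).

Definition gnorm (b : M) : M := gsum (fun r : K => act r b).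

Lemma normE b : norm b = gnorm b.
Proof. by rewrite /gnorm gsum.unlock. Qed.

Lemma gnormD : is_additive gnorm.
Proof. by move=> x y; rewrite -gsumD //; apply: eq_gsum => r; apply: actD. Qed.

Definition nak_sum (s : K) : M := gsum (fun r => f r s).

(** A relation in place of a map into invariants modulo norms: [nak_sum s] represents the Nakayama
    image of [s]. *)
Definition nak_rel (s : K) (m : M) : Prop := exists b, m = nak_sum s + gnorm b.

(** Sum the cocycle identity over its first variable; the sum of [f (r * s) t] over [r] is
    [nak_sum t] by translation. *)
Lemma nak_sumM s t : nak_sum s + nak_sum t = nak_sum (s * t)%g + gnorm (f s t).
Proof.
have := eq_gsum (fun r => fE r s t); rewrite !gsumD // => e.
rewrite (gsum_shiftr s (fun r => f r t)) in e; rewrite /nak_sum /gnorm.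
by zmod1 e.
Qed.

Lemma nak_sum1 : nak_sum 1%g = gnorm (f 1%g 1%g).
Proof.
apply: eq_gsum => r; have := fE r 1%g 1%g; rewrite !mulg1.
by move=> /addIr ->.
Qed.

Lemma nak_rel_norm b : nak_rel 1%g (gnorm b).
Proof.
by exists (b - f 1%g 1%g); rewrite nak_sum1 (is_additiveB gnormD); zmod.
Qed.

Lemma nak_rel_mul s t m n :
  nak_rel s m -> nak_rel t n -> nak_rel (s * t)%g (m + n).
Proof.
move=> [b ->] [c ->]; exists (f s t + (b + c)); rewrite !gnormD.
by zmod1 (nak_sumM s t).
Qed.

Lemma nak_rel_inv s m : nak_rel s m -> nak_rel s^-1%g (- m).
Proof.
move=> [b ->]; exists (- (f s s^-1%g + f 1%g 1%g + b)).
rewrite (is_additiveN gnormD) !gnormD -nak_sum1.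
have := nak_sumM s s^-1%g; rewrite mulgV => e; by zmod1 e.
Qed.

(* If [nak_sum x = gnorm b], then the cup product of [x] with the Bockstein [d]
   of the character [c / n] vanishes, being that of a norm; on the other hand
   this product is [c x] times the class of [f]. *)
Lemma nak_sum_character n (c : K -> int) (d : K -> K -> int) x b :
  ([set: K] #= `I_n)%card ->
  (forall s t, c s + c t - c (s * t)%g = n%:Z * d s t) ->
  nak_sum x = gnorm b ->
  exists e : K -> M, forall s t,
    f s t *~ c x = e s + act s (e t) - e (s * t)%g.
Proof.
move=> Kn cd xb.
have n0 : n%:Z != 0.
  apply/negP => /eqP[n0]; move: Kn; rewrite n0 => /card_set_bijP[g [gT _ _]].
  by have /= := gT 1%g I.
(* [n d] is the coboundary of [c] and the integers are torsion-free, so [d] is a 2-cocycle. *)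
have dE s t r : d s (t * r)%g + d t r = d (s * t)%g r + d s t.
  by apply: (mulfI n0); rewrite !mulrDr -!cd !mulgA; zmod.
(* The coboundary of [e3] is [gnorm b *~ d], that of [e1] is [nak_sum x *~ d] plus an error, and
   that of [e2] is [f *~ c x] plus an error. The two errors agree after reindexing, whence the final
   witness [e2 + e3 - e1]. *)
pose e1 s := gsum (fun r => f (s * r)%g x *~ d s r).
pose e2 s := gsum (fun r => f s (r * x)%g *~ d r x).
pose e3 s := gsum (fun r => act (s * r)%g b *~ d s r).
have aM g : is_additive (@act K M g) by exact: actD.
have mzD (k : int) : is_additive (fun y : M => y *~ k).
  by move=> y z; rewrite mulrzDl.
have bd3 s t : e3 s + act s (e3 t) = e3 (s * t)%g + gnorm b *~ d s t.
  rewrite /e3 /gnorm (gsum_additive finK _ (aM s)) (gsum_additive finK _ (mzD _)).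
  rewrite -(gsum_shiftl t) -(gsum_shiftl (s * t)%g (fun r => act r b *~ _)).
  rewrite -!gsumD //; apply: eq_gsum => r.
  rewrite (is_additiveMz (aM s)) -actM !mulgA -!mulrzDr.
  by congr (_ *~ _); zlc (dE s t r); zmod.
have bd1 s t : e1 s + act s (e1 t) = e1 (s * t)%g + nak_sum x *~ d s t +
    gsum (fun r => f s (t * r)%g *~ d t r - f s (t * r * x)%g *~ d t r).
  rewrite /e1 /nak_sum (gsum_additive finK _ (aM s)) (gsum_additive finK _ (mzD _)).
  rewrite -(gsum_shiftl t (fun r => f (s * r)%g x *~ _)).
  rewrite -(gsum_shiftl (s * t)%g (fun r => f r x *~ _)).
  rewrite -!gsumD //; apply: eq_gsum => r.
  rewrite (is_additiveMz (aM s)).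
  have h2 := congr1 (fun y => y *~ d t r) (fE s (t * r)%g x).
  have h1 := congr1 (fun k => f (s * t * r)%g x *~ k) (dE s t r).
  rewrite /= !mulrzDl !mulgA in h2; rewrite /= !mulrzDr in h1; rewrite !mulgA.
  by zmod2 h1 h2.
have bd2 s t : e2 s + act s (e2 t) = e2 (s * t)%g + f s t *~ c x +
    gsum (fun r => f s (r * x)%g *~ d r x - f s (t * r * x)%g *~ d r x).
  (* Summing [c r + c x - c (r * x) = n d(r, x)] over [r] leaves [n c(x)], as the first and last
     sums cancel. *)
  have -> : c x = gsum (fun r => d r x).
    apply: (mulfI n0).
    rewrite (gsum_additive finK (p := fun k => n%:Z * k)); last exact: mulrDr.
    under eq_gsum do rewrite -cd.
    rewrite !gsumD // gsumN // (gsum_shiftr x c) addrAC subrr add0r.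
    by rewrite (gsum_const _ Kn) mulrC -mulr_natr natz.
  rewrite /e2 (gsum_additive finK _ (aM s)) -gsum_mulz //.
  rewrite -!gsumD //; apply: eq_gsum => r.
  rewrite (is_additiveMz (aM s)).
  have h2 := congr1 (fun y => y *~ d r x) (fE s t (r * x)%g).
  rewrite /= !mulrzDl !mulgA in h2; rewrite ?mulgA.
  by zmod1 h2.
exists (fun s => e2 s + e3 s - e1 s) => s t.
have [b1 [b2 b3]] := (bd1 s t, (bd2 s t, bd3 s t)).
have e : gsum (fun r => f s (t * r)%g *~ d t r - f s (t * r * x)%g *~ d t r) =
    gsum (fun r => f s (r * x)%g *~ d r x - f s (t * r * x)%g *~ d r x).
  rewrite !gsumD // -(gsum_shiftr x (fun r => f s (t * r)%g *~ d t r)).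
  rewrite -(gsum_shiftl t (fun r => f s (r * x)%g *~ d r x)).
  rewrite -!gsumD //; apply: eq_gsum => r; rewrite !mulgA.
  have h := congr1 (fun k => f s (t * r * x)%g *~ k) (dE t r x).
  rewrite /= !mulrzDr in h.
  by zmod1 h.
rewrite (is_additiveB (aM s)) actD.
by rewrite e xb in b1; zmod3 b1 b2 b3.
Qed.
End NakayamaRelation.

(** * Linear characters and the commutator subgroup of a finite group *)

Module GroupCharacter.
Import fingroup.fingroup commutator cyclic algC cyclotomic classfun.
Import character.character.

(** The linear characters have the commutator subgroup as common kernel; [c] records the exponents
    of the values of one of them, as powers of a primitive root of unity of order [#|gT|]. *)
Lemma finite_separating_character (gT : finGroupType) (x : gT) :
  x \notin [~: finset.setTfor gT, finset.setTfor gT]%g ->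
  exists c : gT -> nat,
    (forall s t, c s + c t = c (s * t)%g %[mod #|gT|])%N /\ ~~ (#|gT| %| c x)%N.
Proof.
pose G := [group of finset.setTfor gT]%g; have cardG : #|gT| = #|G|.
  by rewrite cardsT.
have inG y : y \in G by rewrite inE.
rewrite -derg1 -(cap_cfker_lin_irr G) => nx.
have [i lini kx] : exists2 i : Iirr G, ('chi_i)%R \is a linear_char &
    x \notin cfker 'chi_i.
  apply: contrapT => h; move/negP: nx; apply; apply/finset.bigcapP => i lini.
  by apply: contrapT => /negP kx; apply: h; exists i.
have [z zP] := C_prim_root_exists (cardG_gt0 G).
have ex y : exists k : nat, ('chi_i y == z ^+ k)%R.
  have : ('chi_i y ^+ #|G| = 1)%R.
    by rewrite -lin_charX // (expg_cardG (inG y)) lin_char1.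
  by move/(prim_rootP zP) => [k ->]; exists k.
pose c y := xchoose (ex y).
have cE y : ('chi_i y = z ^+ c y)%R by apply/eqP/(xchooseP (ex y)).
exists c; rewrite cardG; split=> [s t|].
  by apply/eqP; rewrite -(eq_prim_root_expr zP) exprD -!cE lin_charM.
apply: contra kx => dv; rewrite cfkerEirr inE cE lin_char1 //.
by rewrite -(prim_order_dvd zP).
Qed.

(** An enumeration of [K] turns it into a [finGroupType] with the same multiplication. The carry [d]
    of the integer lift [c] represents the Bockstein of the character [c / n]. *)
Lemma separating_character (K : groupType) (n : nat) (x : K) :
  ([set: K] #= `I_n)%card -> ~ derived x ->
  exists (c : K -> int) (d : K -> K -> int),
    (forall s t, c s + c t - c (s * t)%g = n%:Z * d s t) /\ ~~ (n%:Z %| c x)%Z.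
Proof.
move=> Kn nx; have finK : finite_set [set: K] by exists n.
pose e : seq K := finmap.enum_fset (fset_set [set: K]).
have eP y : y \in e by rewrite in_fset_set //; apply: mem_set.
have pK : pcancel (index^~ e) (onth e).
  by move=> y; rewrite onthE (nth_map y) ?nth_index ?index_mem.
pose mC := isCountable.Build K pK.
pose cT : countType := HB.pack K mC.
have fin : @Finite.axiom cT e.
  by move=> y; rewrite count_uniq_mem ?finmap.fset_uniq // (eP y).
pose mF := isFinite.Build cT fin.
pose gT : FinGroup.type := HB.pack (Group.sort K) (Group.on K) mC mF.
have cardK : #|gT| = n.
  by rewrite cardT enumT unlock; apply: card_fset_set.
have [|c [cM cx]] := @finite_separating_character gT x.
  apply/negP => dx; apply: nx => S sS cS.
  pose B := finset.finset (fun y : gT => `[< S y >]).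
  have gB : group_set B.
    apply/group_setP; split=> [|y z]; rewrite !inE.
      by apply/asboolP; apply: subgroup1 sS.
    by move=> /asboolP Sy /asboolP Sz; apply/asboolP; apply: subgroupM sS _ _ _ _.
  have sub : [~: finset.setTfor gT, finset.setTfor gT]%g \subset Group gB.
    rewrite gen_subG; apply/fintype.subsetP => _ /finset.imset2P[h k _ _ ->].
    by rewrite inE; apply/asboolP; apply: cS.
  have := fintype.subsetP sub x dx.
  by rewrite inE => /asboolP.
exists (fun y => (c y)%:Z).
have dP s t : exists k : int, (c s)%:Z + (c t)%:Z - (c (s * t)%g)%:Z == n%:Z * k.
  have := cM s t; rewrite cardK => cst.
  have : (n%:Z %| (c s)%:Z + (c t)%:Z - (c (s * t)%g)%:Z)%Z.
    by rewrite -eqz_mod_dvd -PoszD !modz_nat cst.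
  by case/dvdzP => k ->; exists k; rewrite mulrC.
exists (fun s t => xchoose (dP s t)); split=> [s t|].
  by apply/eqP/(xchooseP (dP s t)).
by rewrite cardK in cx.
Qed.
End GroupCharacter.

(** * Norms over a finite normal subgroup *)

Section Level.
Variables (K Q : groupType) (i : K -> Q).
Hypothesis iM : forall k l, i (k * l)%g = (i k * i l)%g.
Hypothesis i_inj : injective i.
Hypothesis i_normal : forall g k, exists k', (g * i k = i k' * g)%g.
Hypothesis finK : finite_set [set: K].
Variables (M : gmod Q) (f : Q -> Q -> M) (fE : cocycle2 f).

Definition rnorm (y : M) : M := gsum (fun r => act (i r) y).
Definition rnak (g : Q) : M := gsum (fun r => f (i r) g).

(** Conjugation by [g] permutes the image of [K], which is normal. *)
Lemma gsum_conj (N : zmodType) g (F : Q -> N) :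
  gsum (fun r => F (i r * g)%g) = gsum (fun r => F (g * i r)%g).
Proof.
pose c r := sval (cid (i_normal g r)).
have cP r : (g * i r = i (c r) * g)%g := svalP (cid (i_normal g r)).
rewrite gsum.unlock [LHS](@reindex_fsbig _ _ _ _ _ c setT setT).
  by apply: eq_fsbigr => r _; rewrite cP.
split=> // [r s _ _ crs|k _].
  by apply: i_inj; apply: (@mulgI _ g); rewrite !cP crs.
have [l lP] := i_normal g^-1%g k; exists l => //.
apply: i_inj; apply: (@mulIg _ g); rewrite -cP.
by apply: (@mulgI _ g^-1%g); rewrite mulgA mulVg mul1g mulgA lP mulgVK.
Qed.

Lemma rnorm_act g y : act g (rnorm y) = rnorm (act g y).
Proof.
rewrite /rnorm (gsum_additive finK _ (act_additive g)).
under eq_gsum do rewrite -actM; under [RHS]eq_gsum do rewrite -actM.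
by rewrite (gsum_conj g (fun x => act x y)).
Qed.

(** The cocycle identity is summed over [K] in its first variable here, in the middle one in
    [rnak_cob2], and in the last one in [S_cob] below. *)
Let rnak_cob1 s t :
  rnorm (f s t) + rnak (s * t)%g = gsum (fun r => f (i r * s)%g t) + rnak s.
Proof. by rewrite -!gsumD //; apply: eq_gsum => r; apply: fE. Qed.

Let rnak_cob2 s t : act s (rnak t) + gsum (fun r => f s (i r * t)%g) =
  gsum (fun r => f (i r * s)%g t) + gsum (fun r => f s (i r)).
Proof.
rewrite (gsum_conj s (f^~ t)) /rnak (gsum_additive finK _ (act_additive _)).
by rewrite -!gsumD //; apply: eq_gsum => r; apply: fE.
Qed.

Let gsum_iM (F : Q -> M) k :
  gsum (fun r => F (i r * i k)%g) = gsum (fun r => F (i r)).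
Proof. by rewrite -[RHS](gsum_shiftr k); apply: eq_gsum => r; rewrite iM. Qed.

(* In the extension attached to [f], with [e_g] lifting [[g] - 1], the norm of
   [e_g] over [K] is [sum_r (e_(r g) - e_r) + rnak g].  Modulo norms it is a
   1-cocycle with the restriction [rnak] to [K]; [nu] is the difference with a
   lift that factors through the quotient by [K]. *)
Lemma inflation_norm n (a : Q -> Q -> M) (b : Q -> M) :
  ([set: K] #= `I_n)%card ->
  (forall mu : K -> M,
     (forall k l, mu (k * l)%g = mu k + act (i k) (mu l)) ->
     exists y, forall k, mu k = act (i k) y - y) ->
  (forall s t, a s t = f s t *+ n + (b s + act s (b t) - b (s * t)%g)) ->
  (forall k s, a (i k) s = 0) -> (forall k s, a s (i k) = 0) ->
  exists nu : Q -> M,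
    [/\ forall s t, nu s + act s (nu t) + a s t = nu (s * t)%g + rnorm (f s t),
        forall k, nu (i k) = rnak (i k)
      & forall k s, act (i k) (nu s) = nu s].
Proof.
move=> Kn H1 ab a0l a0r.
pose S s := gsum (fun r => f s (i r)).
have S_cob s t : act s (S t) + gsum (fun r => f s (i r * t)%g) =
    S (s * t)%g + f s t *+ n.
  rewrite (gsum_conj t (f s)) /S (gsum_additive finK _ (act_additive _)).
  by rewrite -(gsum_const _ Kn) -!gsumD //; apply: eq_gsum => r; apply: fE.
(* By the three summed identities, [rnak - S] has coboundary [rnorm f - f *+ n]; subtracting [b]
   turns [f *+ n] into [a]. *)
pose nu0 s := rnak s - S s - b s.
have nu0_cob s t : nu0 s + act s (nu0 t) + a s t = nu0 (s * t)%g + rnorm (f s t).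
  rewrite /nu0 ab !(is_additiveB (act_additive s)).
  zlc (esym (rnak_cob1 s t)); zlc (rnak_cob2 s t).
  by zmod1 (S_cob s t).
(* As [a] vanishes on [K], [nu0] and [rnak] have the same coboundary there. Their difference is thus
   the coboundary of some [y], which is then subtracted on all of [Q]. *)
have [|y yP] := H1 (fun k => nu0 (i k) - rnak (i k)).
  move=> k l; rewrite (is_additiveB (act_additive _)) iM.
  have e1 := rnak_cob1 (i k) (i l); have e2 := rnak_cob2 (i k) (i l).
  have e3 := nu0_cob (i k) (i l); rewrite a0l in e3.
  rewrite (gsum_iM (f (i k))) in e2.
  by zmod3 e1 e2 e3.
pose nu s := nu0 s - (act s y - y).
have nuP s t : nu s + act s (nu t) + a s t = nu (s * t)%g + rnorm (f s t).
  rewrite /nu (is_additiveB (act_additive s) (nu0 t)) actM.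
  rewrite (is_additiveB (act_additive s) (act t y)).
  by zmod1 (nu0_cob s t).
have nuK k : nu (i k) = rnak (i k) by rewrite /nu -yP; zmod.
exists nu; split=> // k g.
(* Invariance comes from writing [k g = g k'] and expanding [nu] at this product in both ways. *)
have [k' kk'] := i_normal g^-1%g k.
have {kk'}kg : (i k * g = g * i k')%g.
  by apply: (@mulgI _ g^-1%g); rewrite !mulgA kk' mulVg mul1g mulgVK.
have e1 := nuP (i k) g; have e2 := nuP g (i k').
rewrite a0l nuK kg in e1; rewrite a0r nuK in e2.
have e3 := rnak_cob2 g (i k'); have e4 := rnak_cob1 g (i k').
have e5 := rnak_cob1 (i k) g.
rewrite (gsum_iM (f g)) in e3; rewrite (gsum_iM (f^~ g)) kg -/(rnak g) in e5.
by zlc e1; zlc (esym e2); zlc e3; zlc (esym e4); zmod1 e5.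
Qed.

End Level.

(** * Homogeneous and inhomogeneous cocycles *)

Section Inhomogeneous.
Variables (Q : groupType) (M : gmod Q).

Lemma fun2E (x : 'I_2 -> Q) :
  x = tnth [tuple x ord0; x ord_max].
Proof. by apply/funext => -[[|[|[]]] //= h]; congr x; apply: val_inj. Qed.

Lemma fun3E (x : 'I_3 -> Q) :
  x = tnth [tuple x ord0; x (inord 1); x ord_max].
Proof.
apply/funext => -[[|[|[|[]]]] //= h]; congr x; apply: val_inj => //=.
by rewrite inordK.
Qed.

Lemma mul_tnth2 g (a b : Q) :
  (fun k => g * tnth [tuple a; b] k)%g = tnth [tuple g * a; g * b]%g.
Proof. by apply/funext => -[[|[|[]]] //= h]. Qed.

Lemma mul_tnth3 g (a b c : Q) :
  (fun k => g * tnth [tuple a; b; c] k)%g = tnth [tuple g * a; g * b; g * c]%g.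
Proof. by apply/funext => -[[|[|[|[]]]] //= h]. Qed.

Lemma cobd0E (e : cochain M 0) x :
  cobd e x = e (fun=> x ord_max) - e (fun=> x ord0).
Proof.
rewrite /cobd !big_ord_recl big_ord0 /bump /= !exprS expr0 mulr1 mulr1z.
rewrite mulrN1z addr0.
by congr (e _ - e _); apply/funext => -[[|[]] //= h]; congr x; apply: val_inj.
Qed.

Lemma cobd1E (e : cochain M 1) a b c : cobd e (tnth [tuple a; b; c]) =
  e (tnth [tuple b; c]) - e (tnth [tuple a; c]) + e (tnth [tuple a; b]).
Proof.
rewrite /cobd !big_ord_recl big_ord0 /bump /= !exprS expr0 mulr1 mulN1r opprK.
rewrite !mulr1z mulrN1z addr0 addrA.
by congr (e _ - e _ + e _); apply/funext => -[[|[|[]]] //= h].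
Qed.

Lemma cobd2E (e : cochain M 2) a b c d : cobd e (tnth [tuple a; b; c; d]) =
  e (tnth [tuple b; c; d]) - e (tnth [tuple a; c; d]) +
  e (tnth [tuple a; b; d]) - e (tnth [tuple a; b; c]).
Proof.
rewrite /cobd !big_ord_recl big_ord0 /bump /= !exprS expr0 mulr1 !mulN1r opprK.
rewrite !mulr1z !mulrN1z addr0 !addrA.
by congr (e _ - e _ + e _ - e _); apply/funext => -[[|[|[|[]]]] //= h].
Qed.

Lemma cobd_lin n (e e' : cochain M n) (k l : int) x :
  cobd (fun y => e y *~ k + e' y *~ l) x = cobd e x *~ k + cobd e' x *~ l.
Proof.
rewrite /cobd !mulrz_suml -big_split; apply: eq_bigr => r _ /=.
by rewrite mulrzDl -!mulrzA ![(_ * (-1) ^+ r)%R]mulrC.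
Qed.

Definition inhom2 (F : cochain M 2) (s t : Q) : M :=
  F (tnth [tuple 1; s; s * t]%g).

Lemma inhom2E F a b c : equivariant setT F ->
  F (tnth [tuple a; b; c]) = act a (inhom2 F (a^-1 * b)%g (b^-1 * c)%g).
Proof.
by move=> Feq; rewrite -Feq // mul_tnth3 mulg1 !mulgA !(mulgV, mul1g).
Qed.

Lemma inhom2_cocycle F : cocycle setT F -> cocycle2 (inhom2 F).
Proof.
move=> [Feq F0] s t r.
have := F0 (tnth [tuple 1; s; s * t; s * t * r]%g); rewrite cobd2E => e.
rewrite /inhom2 -Feq // mul_tnth3 mulg1 !mulgA.
by zmod1 e.
Qed.

Lemma inhom2_cohomologous F F' : cohomologous setT F F' ->
  exists b : Q -> M, forall s t,
    inhom2 F s t = inhom2 F' s t + (b s + act s (b t) - b (s * t)%g).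
Proof.
move=> [e eeq eF]; exists (fun s => e (tnth [tuple 1; s]%g)) => s t.
have := eF (tnth [tuple 1; s; s * t]%g).
rewrite cobd1E -eeq // mul_tnth2 mulg1 => h.
by rewrite /inhom2; zmod1 h.
Qed.

(** The cochain [e] is homogenized as [x0 e(x0^-1 x1)]. *)
Lemma coboundary_inhom2 F (c : int) (e : Q -> M) : equivariant setT F ->
  (forall s t, inhom2 F s t *~ c = e s + act s (e t) - e (s * t)%g) ->
  coboundary setT (fun x => F x *~ c).
Proof.
move=> Feq Fe; exists (fun x => act (x ord0) (e ((x ord0)^-1 * x ord_max)%g)).
  by move=> d x _; rewrite actM invgM mulgA mulgVK.
move=> x; rewrite (fun3E x) cobd1E !(tnth_nth 1%g) /= inhom2E //.
rewrite -(is_additiveMz (act_additive _)) Fe.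
rewrite (is_additiveB (act_additive _)) actD -actM.
by rewrite !mulgA mulgV mul1g mulgK; zmod.
Qed.

Lemma H1_trivial_inhom : H1_trivial M setT -> forall mu : Q -> M,
  (forall s t, mu (s * t)%g = mu s + act s (mu t)) ->
  exists y, forall s, mu s = act s y - y.
Proof.
move=> H1 mu muM.
have [|e eeq eF] := H1 (fun x => act (x ord0) (mu ((x ord0)^-1 * x ord_max)%g)).
  split=> [d x _|x].
    by rewrite actM invgM mulgA mulgVK.
  rewrite (fun3E x) cobd1E !(tnth_nth 1%g) /=.
  set a := x ord0; set b := x (inord 1); set c := x ord_max.
  have -> : (a^-1 * c = (a^-1 * b) * (b^-1 * c))%g by rewrite mulgA mulgK.
  by rewrite (muM (a^-1 * b)%g) actD -actM mulgA mulgV mul1g; zmod.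
exists (e (fun=> 1%g)) => s.
have := eF (tnth [tuple 1; s]%g); rewrite cobd0E !(tnth_nth 1%g) /=.
rewrite act1 invg1 mul1g -eeq // => ->.
by rewrite mulg1.
Qed.

Section Finite.
Hypothesis finQ : finite_set [set: Q].

(* The cup product of [Defs] is the sum of [F(r s, r, 1)] over [r], whence the
   inverse. *)
Lemma nakayama_rel F s m : cocycle setT F -> nakayama F s m ->
  nak_rel (inhom2 F) s^-1%g m.
Proof.
move=> [Feq F0] [b /(_ (fun=> 1%g)) ->]; exists b; rewrite normE; congr (_ + _).
transitivity (gsum (fun r : Q => F (tnth [tuple r * s; r; 1]%g))).
  rewrite gsum.unlock; apply: eq_fsbigr => r _.
  rewrite (fsbigD1 (r * s)%g) //= fsbig1 => [|t [_ /= /eqP/negPf ts]].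
    by rewrite addr0 /tate_ab (eqxx (r * s)%g) mulr1z.
  by rewrite /tate_ab ts mulr0z.
(* This is the cocycle identity at [(1, r s, r, 1)]; the terms [F(1, r s, 1)] and [F(1, r, 1)] have
   equal sums over [r] and cancel. *)
have e r : F (tnth [tuple r * s; r; 1]%g) + F (tnth [tuple 1; r * s; 1]%g) =
    inhom2 F (r * s)%g s^-1%g + F (tnth [tuple 1; r; 1]%g).
  have := F0 (tnth [tuple 1; r * s; r; 1]%g); rewrite cobd2E => e.
  by rewrite /inhom2 mulgK; zmod1 e.
have := eq_gsum e; rewrite !gsumD //.
rewrite (gsum_shiftr s (fun r => F (tnth [tuple 1; r; 1]%g))).
by rewrite (gsum_shiftr s (fun r => inhom2 F r s^-1%g)) => /addIr.
Qed.

(** Otherwise some character [c] has [c s] not divisible by [n], while [c s] times the class of [F]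
    is zero. The class of [F'], of exact order [n], is a multiple of that of [F], so [n] would
    divide [c s]. *)
Lemma nak_rel_derived F n s : ([set: Q] #= `I_n)%card ->
  generator setT F -> H2_cyclic_of_order M setT n ->
  nak_rel (inhom2 F) s 0 -> derived s.
Proof.
move=> Qn [Fc Fgen] [F' F'gen F'n] [b bE]; apply: contrapT => ns.
have [c [d [cd /negP]]] := GroupCharacter.separating_character Qn ns; apply.
have [|e eE] :=
  nak_sum_character finQ (inhom2_cocycle Fc) (b := - b) Qn cd (x := s).
  by rewrite (is_additiveN (gnormD finQ (M := M))); zmod1 bE.
have [e1 e1eq e1E] := coboundary_inhom2 Fc.1 eE.
have [k [e2 e2eq e2E]] := Fgen _ F'gen.1.
apply: (F'n (c s)).1.
exists (fun x => e1 x *~ k + e2 x *~ c s).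
  move=> g x _; rewrite actD !(is_additiveMz (act_additive _)).
  by rewrite e1eq // e2eq.
move=> x; rewrite cobd_lin -e2E -e1E mulrzBl -!mulrzA [(k * _)%R]mulrC.
by zmod.
Qed.

End Finite.
End Inhomogeneous.

(** * Class formations modulo an open normal subgroup *)

Section Sections.
Variable G : groupType.

Lemma cls_bot (s : section G) g : bot s g -> cls s g = 1%g.
Proof.
move=> bg; rewrite -cls1; apply/cls_eqP; first exact: bot_sub_top.
  exact: subgroup1 (top_subgroup s).
rewrite mulg1; exact: subgroupV (bot_subgroup s) _ bg.
Qed.

Lemma clsV (s : section G) g : top s g -> (cls s g)^-1%g = cls s g^-1%g.
Proof. exact: qinv_cls. Qed.

Section QuotMap.
Variables s' s : section G.
Hypothesis sub_top : top s' `<=` top s.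
Hypothesis sub_bot : bot s' `<=` bot s.

Lemma quot_map_cls g : top s' g -> quot_map s (cls s' g) = cls s g.
Proof.
move=> tg; apply/esym/cls_eqP; [exact: sub_top|apply: sub_top; exact: qrepr_top|].
by apply: sub_bot; apply: qrepr_cls.
Qed.

Lemma quot_mapM x y :
  quot_map s (x * y : quot s')%g = (quot_map s x * quot_map s y)%g.
Proof.
have [g tg ->] := quotE x; have [h th ->] := quotE y.
rewrite -clsM // !quot_map_cls //; last exact: subgroupM (top_subgroup s') _ _ _ _.
by rewrite clsM //; apply: sub_top.
Qed.

Lemma quot_map1 : quot_map s (1 : quot s')%g = 1%g.
Proof. by rewrite -cls1 quot_map_cls //; apply: subgroup1 (top_subgroup s'). Qed.

End QuotMap.

Lemma card_quot (s : section G) m :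
  has_index (top s) (bot s) m <-> ([set: quot s] #= `I_m)%card.
Proof.
rewrite /has_index.
suff e : ([set lcoset (bot s) k | k in top s] #= [set: quot s])%card.
  by rewrite (card_eql e).
have -> : [set lcoset (bot s) k | k in top s] = @qset _ s @` setT.
  apply/seteqP; split=> [_ [k tk <-]|_ [x _ <-]].
    by exists (cls s k) => //=; rewrite asboolT.
  by have [g tg e] := qsetP x; exists g.
by apply: inj_card_eq => x y _ _; apply: quot_inj.
Qed.

Lemma inhom2_pull (C : gmod G) (s' s : section G) (h : bot s' `<=` bot s)
    (F : cochain (fixmod C s) 2) x y : top s' `<=` top s ->
  inhom2 (pull h F) x y = fix_incl h (inhom2 F (quot_map s x) (quot_map s y)).
Proof.
move=> st; congr (fix_incl h (F _)); apply/funext => -[[|[|[|[]]]] //= lt].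
- exact: quot_map1.
- exact: quot_mapM.
Qed.

Variable C : gmod G.

Lemma fixval_inj (N : set G) : injective (@fixval G C N).
Proof. exact: val_inj. Qed.

Lemma fix_incl_additive (N' N : set G) (h : N' `<=` N) :
  is_additive (@fix_incl G C N' N h).
Proof. by move=> x y; apply: val_inj. Qed.

Lemma fix_incl_id (N : set G) (h : N `<=` N) c : @fix_incl G C N N h c = c.
Proof. exact: val_inj. Qed.

Lemma act_cls (s : section G) g (c : fixmod C s) :
  top s g -> fixval (act (cls s g) c) = act g (fixval c).
Proof. exact: fix_act_cls. Qed.

End Sections.

Section ClassFormation.
Variables (G : topGroupType) (C : class_formation G) (H : open_normal G).

Section Sublevel.
Variables (U : open_normal G) (UH : onset U `<=` onset H).

Definition sub_section : section G :=
  @Section G H U (onset_subgroup H) (onset_subgroup U) UH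
    (fun k n _ Un => onset_normal k Un).


Let K : groupType := quot sub_section.
Let Q : groupType := quot (full_section U).
Let Gam : groupType := quot (full_section H).
Let MK := fixmod C sub_section.
Let MQ := fixmod C (full_section U).
Let MG := fixmod C (full_section H).
(** [i] is the inclusion of [H/U] into [G/U], and [p] below is the projection of [G/U] onto
    [G/H]. *)
Let i : K -> Q := quot_map (full_section U) (s' := sub_section).
Let p : Q -> Gam := quot_map (full_section H) (s' := full_section U).
Let fK : K -> K -> MK := inhom2 (fund C sub_section).
Let fQ : Q -> Q -> MQ := inhom2 (fund C (full_section U)).

Let open_s : open_section sub_section.
Proof. by split; apply: onset_open. Qed.

Let open_full (V : open_normal G) : open_section (full_section V).
Proof. by split; [exact: openT|apply: onset_open]. Qed.

Let incl : MG -> MQ := @fix_incl G C U H UH.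

(* [m] represents the image of [x] under the Nakayama map of [H/U]. *)
Definition level_rel (x : G) (m : fixpts C H) : Prop :=
  nak_rel fK (cls sub_section x) (@fix_incl G C U H UH m).

Let cardK : exists n, ([set: K] #= `I_n)%card.
Proof.
by have [_ [n Kn _]] := cf_class_module C open_s (@subgroup_setT K); exists n.
Qed.

Let finK : finite_set [set: K].
Proof. by have [n] := cardK; exists n. Qed.

Let fKP : cocycle setT (fund C sub_section) := (fundP C open_s).1.
Let fKE : cocycle2 fK := inhom2_cocycle fKP.
Let fQP : cocycle setT (fund C (full_section U)) := (fundP C (open_full U)).1.
Let fQE : cocycle2 fQ := inhom2_cocycle fQP.

Lemma level_relM x y m n : onset H x -> onset H y ->
  level_rel x m -> level_rel y n -> level_rel (x * y)%g (m + n).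
Proof.
move=> Hx Hy rx ry; rewrite /level_rel clsM // fix_incl_additive.
exact: (nak_rel_mul finK fKE rx ry).
Qed.

Lemma level_relV x m : onset H x ->
  level_rel x m -> level_rel x^-1%g (- m).
Proof.
move=> Hx rx; rewrite /level_rel -clsV // (is_additiveN (fix_incl_additive _)).
exact: (nak_rel_inv finK fKE rx).
Qed.

(** Injectivity of the Nakayama map on the abelianization of [H/U]; the class module axiom supplies
    an [H^2] of order [#(H/U)]. *)
Lemma level_rel0 x : onset H x -> level_rel x 0 -> derived (cls sub_section x).
Proof.
move=> Hx; rewrite /level_rel (is_additive0 (fix_incl_additive _)).
have [_ [n Kn cyc]] := cf_class_module C open_s (@subgroup_setT K).
exact: (nak_rel_derived finK Kn (fundP C open_s) cyc).
Qed.

(** The inverse is the one introduced by [nakayama_rel]. *)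
Lemma level_rel_reciprocity (rec : fixpts C H -> profinite_ab H) c h :
  reciprocity rec -> onset H h -> rec c = ab_class H h -> level_rel h^-1%g c.
Proof.
move=> recP Hh ch; rewrite /level_rel -clsV //.
by apply: (nakayama_rel finK fKP); apply: (recP c h).
Qed.

Let act_i k (y : MQ) : act (i k) y = act k (y : MK).
Proof.
have [h Hh ->] := quotE k; apply: fixval_inj; rewrite /i quot_map_cls //.
by rewrite !act_cls.
Qed.

Let incl_act s (y : MG) : incl (act (p s) y) = act s (incl y).
Proof.
have [g _ ->] := quotE s; apply: fixval_inj; rewrite /p quot_map_cls //.
by rewrite [LHS]act_cls // act_cls.
Qed.

Let inclD : is_additive incl := @fix_incl_additive G C U H UH.
Let inclB := is_additiveB inclD.

Let iM k l : i (k * l)%g = (i k * i l)%g.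
Proof. exact: quot_mapM. Qed.

Let i_inj : injective i.
Proof.
move=> x y; have [h Hh ->] := quotE x; have [k Hk ->] := quotE y.
rewrite /i !quot_map_cls // => /cls_eqP e.
by apply/cls_eqP => //; apply: e.
Qed.

Let i_normal g k : exists k', (g * i k = i k' * g)%g.
Proof.
have [x _ ->] := quotE g; have [h Hh ->] := quotE k.
have Hxh := onset_normal x Hh.
exists (cls sub_section (x * h * x^-1)%g).
by rewrite /i !quot_map_cls // -!clsM // mulgVK.
Qed.

Let pi k : p (i k) = 1%g.
Proof.
have [h Hh ->] := quotE k; rewrite /i quot_map_cls // /p quot_map_cls //.
exact: cls_bot.
Qed.

Let rnorm_gnorm y : rnorm i (y : MQ) = gnorm (y : MK).
Proof. by apply: eq_gsum => r; apply: act_i. Qed.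

Let rel1P m : level_rel 1%g m <-> exists b, incl m = rnorm i b.
Proof.
rewrite /level_rel cls1; split=> [[b e]|[b e]].
  exists (fK 1%g 1%g + b : MK); rewrite rnorm_gnorm (gnormD finK (M := MK)).
  by rewrite -nak_sum1.
by rewrite -/incl e rnorm_gnorm; apply: nak_rel_norm.
Qed.

(** Elements related to 1 are norms from [C^U], and the norm over the normal subgroup [H/U] commutes
    with [G/U]. *)
Lemma level_rel1_act g (m : MG) :
  level_rel 1%g m -> level_rel 1%g (act (cls (full_section H) g) m : MG).
Proof.
move=> /rel1P[b e]; apply/rel1P; exists (act (cls (full_section U) g) b).
rewrite -(rnorm_act i_inj i_normal finK) -e -incl_act.
by congr (incl (act _ _)); rewrite /p quot_map_cls.
Qed.

Let fQ_fK : exists b : K -> MK, forall k l,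
  fQ (i k) (i l) = fK k l + (b k + act k (b l) - b (k * l)%g).
Proof.
have h : bot sub_section `<=` bot (full_section U) by [].
have := fund_res C h open_s (open_full U) (@subsetT _ _) erefl.
move=> /inhom2_cohomologous[b bE]; exists b => k l.
by rewrite -bE inhom2_pull // fix_incl_id.
Qed.

Section Lift.
Variables (a : Gam -> Gam -> MG) (beta : Gam -> MG).
Hypothesis aE : forall x y, a x y = inhom2 (fund C (full_section H)) x y +
  (beta x + act x (beta y) - beta (x * y)%g).
Hypothesis a1l : forall y, a 1%g y = 0.
Hypothesis a1r : forall y, a y 1%g = 0.

(** By [fund_inf], [[H:U]] times the class of [G/U] is the inflation of that of [G/H], so that
    [inflation_norm] applies to the inflation of [a]. *)
Lemma level_lift : exists nu : G -> MG,
  (forall s t, level_rel 1%g (nu s + act (cls (full_section H) s) (nu t) +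
     a (cls _ s) (cls _ t) - nu (s * t)%g)) /\
  (forall h, onset H h -> level_rel h (nu h)).
Proof.
have [n Kn] := cardK.
have ind : has_index (onset H) (onset U) n by apply/(card_quot sub_section).
have := fund_inf C (UH : bot (full_section U) `<=` bot (full_section H))
  (open_full U) (open_full H) erefl ind.
move=> /inhom2_cohomologous[b bE].
pose b' s : MQ := b s + incl (beta (p s)).
have pM x y : p (x * y)%g = (p x * p y)%g by exact: quot_mapM.
have aQ s t : incl (a (p s) (p t)) =
    fQ s t *+ n + (b' s + act s (b' t) - b' (s * t)%g).
  have := bE s t; rewrite inhom2_pull // -/incl -/p => e.
  by rewrite aE /b' actD -incl_act pM inclD inclB inclD; zmod1 e.
have H1 := H1_trivial_inhom (cf_class_module C open_s (@subgroup_setT K)).1.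
have [||||nu [nuM nuK nuH]] := inflation_norm iM i_inj i_normal finK fQE
    Kn (a := fun s t => incl (a (p s) (p t))) (b := b').
- move=> mu muM; have [|y yP] := H1 mu.
    by move=> k l; rewrite muM act_i.
  by exists y => k; rewrite act_i; apply: yP.
- exact: aQ.
- by move=> k s; rewrite pi a1l; apply: is_additive0 inclD.
- by move=> k s; rewrite pi a1r; apply: is_additive0 inclD.
(* Invariance under [H/U] puts the values of [nu] in [C^H]. *)
have fixH g : `[< forall h, onset H h ->
    act h (fixval (nu (cls _ g))) = fixval (nu (cls _ g)) >].
  apply/asboolP => h Hh; rewrite -[RHS](congr1 _ (nuH (cls sub_section h) _)).
  by rewrite /i quot_map_cls // act_cls.
pose nuG g : MG := Fixpts (fixH g).
have inclnu g : incl (nuG g) = nu (cls _ g) by exact: fixval_inj.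
exists nuG; split=> [s t|h Hh].
  apply/rel1P; exists (fQ (cls _ s) (cls _ t)).
  rewrite inclB !inclD.
  have pcls g : cls (full_section H) g = p (cls (full_section U) g).
    by rewrite /p quot_map_cls.
  rewrite !inclnu !pcls incl_act inclnu clsM //.
  by zmod1 (nuM (cls _ s) (cls _ t)).
rewrite /level_rel -/incl inclnu.
have -> : cls (full_section U) h = i (cls sub_section h).
  by rewrite /i quot_map_cls.
(* The restriction of [fQ] to [H/U] is [fK] plus the coboundary of [b2]; summed over the first
   variable, this coboundary becomes the norm of [b2 k]. *)
have [b2 b2E] := fQ_fK; set k := cls sub_section h; exists (b2 k).
rewrite nuK /rnak /nak_sum /gnorm.
have := eq_gsum (fun r => b2E r k).
rewrite !gsumD // gsumN // (gsum_shiftr k b2) => e.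
by zmod1 e.
Qed.

(** With [y = g x g^-1], expand [nu] at [g x = y g] in both ways: the terms in [a] vanish since [x]
    and [y] lie in [H], so [g (nu x)] is [nu y] modulo norms. As [nu x] represents the image of [x],
    it differs from [m] by a norm. *)
Lemma level_rel_act g x (m : MG) : onset H x -> level_rel x m ->
  level_rel (g * x * g^-1)%g (act (cls (full_section H) g) m : MG).
Proof.
move=> Hx xm; have [nu [nuM nuH]] := level_lift.
have H1 := subgroup1 (onset_subgroup H).
have Hg := onset_normal g Hx; set y := (g * x * g^-1)%g in Hg *.
have r0 : level_rel 1%g (act (cls _ g) (m - nu x) : MG).
  apply: level_rel1_act; rewrite -(mulgV x); apply: level_relM => //.
    exact: subgroupV (onset_subgroup H) _ Hx.
  by apply: level_relV => //; apply: nuH.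
have r1 := nuM g x; have r2 := nuM y g.
rewrite (cls_bot (s := full_section H) Hx) a1r in r1.
rewrite (cls_bot (s := full_section H) Hg) a1l act1 in r2.
have rM m1 m2 : level_rel 1%g m1 -> level_rel 1%g m2 -> level_rel 1%g (m1 + m2).
  by move=> rm rn; have := level_relM H1 H1 rm rn; rewrite mulg1.
have := level_relV H1 r2; rewrite invg1 => r2N.
have := level_relM H1 Hg (rM _ _ r0 (rM _ _ r1 r2N)) (nuH y Hg).
rewrite mul1g (is_additiveB (act_additive _)); congr level_rel.
by rewrite (_ : y * g = g * x)%g ?mulgVK //; zmod.
Qed.

End Lift.

End Sublevel.
End ClassFormation.

(** * Open normal subgroups of profinite groups *)

Section CompactSpaces.
Variable T : topologicalType.
Hypothesis cT : compact [set: T].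

Lemma compact_directed (D : set (set T)) :
  D !=set0 -> (forall A, D A -> closed A /\ A !=set0) ->
  (forall A B, D A -> D B -> exists2 C, D C & C `<=` A `&` B) ->
  exists x, forall A, D A -> A x.
Proof.
move=> D0 Dc Dd; pose F := filter_from D id.
have FF : Filter F by apply: filter_from_filter => // A B /Dd; apply.
have PF : ProperFilter F by apply: filter_from_proper => A /Dc[].
have [x [_ xF]] := cT PF (filterT : F setT); exists x => A DA.
have [cA _] := Dc A DA; apply: cA => B Bx.
by apply: xF => //; exists A.
Qed.

(* In a compact Hausdorff space the intersection [Q] of the clopen sets around a
   point is connected. *)
Lemma compact_zero_dimensional :
  hausdorff_space T -> totally_disconnected [set: T] -> zero_dimensional T.
Proof.
have abs (A B : set T) z : A `&` B = set0 -> A z -> B z -> False.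
  by move=> AB Az Bz; have : (A `&` B) z by []; rewrite AB.
move=> hT td x y xy; apply: contrapT => nsep.
pose Cl := [set D : set T | clopen D /\ D x].
pose Q := \bigcap_(D in Cl) D.
have Qx : Q x by move=> D [].
have Qy : Q y.
  by move=> D [cD Dx]; apply: contrapT => nDy; apply: nsep; exists D.
have cQ : closed Q by apply: closed_bigI => D [[]].
suff conQ : connected Q.
  have : connected_component setT x y by exists Q.
  by rewrite td // => yx; rewrite yx eqxx in xy.
apply: contrapT => /connectedPn[E [E0 QE [sep1 sep2]]].
have clE b : closed (E b) /\ E b `&` E (~~ b) = set0.
  have EQ c : E c `<=` Q by rewrite QE => z; case: c; [right|left].
  have dis : E b `&` E (~~ b) = set0.
    rewrite -subset0 => z [zb zb']; case: b zb zb' => zb zb'.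
      by apply: (abs _ _ z sep1 _ zb); apply: subset_closure.
    by apply: (abs _ _ z sep1 _ zb'); apply: subset_closure.
  split=> // z zE.
  have : Q z by apply: cQ; apply: closureS zE.
  rewrite QE; case: b zE {dis} => zE [] // Ez; exfalso.
    exact: abs _ _ z sep2 Ez zE.
  exact: abs _ _ z sep1 zE Ez.
have [b Ebx] : exists b, E b x.
  by move: Qx; rewrite QE => -[]; [exists false|exists true].
have [clb dis] := clE b; have [clb' _] := clE (~~ b).
have nE : set_nbhs (E b) (~` E (~~ b)).
  apply/set_nbhsP; exists (~` E (~~ b)); split=> //; first exact: closed_openC.
  by move=> z zb zb'; apply: (abs _ _ z dis).
have [V /set_nbhsP[W [oW EW WV]] clV] := compact_normal hT cT clb nE.
have clW : closure W `&` E (~~ b) = set0.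
  by rewrite -subset0 => z [/(closureS WV)/clV].
(* [Q] misses [closure W] minus [W], so by compactness some clopen [D] around [x] already misses it.
   Then [D] meets [W] in a clopen set that contains [x] and avoids [E (~~ b)]. *)
pose S := [set D `&` (closure W `\` W) | D in Cl].
have [D [[oD cD] Dx] DW] : exists2 D, Cl D & D `&` (closure W `\` W) = set0.
  apply: contrapT => nD.
  have [||A B [D [cD Dx] <-] [D' [cD' D'x] <-]|z zS] := @compact_directed S.
  - by exists (setT `&` (closure W `\` W)), setT => //; split => //; exact: clopenT.
  - move=> _ [D [cD Dx] <-]; split.
      apply: closedI; first exact: cD.2.
      rewrite setDE; apply: closedI; first exact: closed_closure.
      exact: open_closedC.
    by apply/set0P/eqP => D0; apply: nD; exists D.
  - exists (D `&` D' `&` (closure W `\` W)).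
      by exists (D `&` D') => //; split=> //; exact: clopenI.
    by move=> z [[]].
  - have zQ : Q z by move=> D DC; have [] := zS _ (imageP _ DC).
    have [_ [zW nzW]] := zS _ (imageP _ (conj clopenT I : Cl setT)).
    move: zQ; rewrite QE => Ez; have : E b z \/ E (~~ b) z.
      by case: (b) Ez => -[]; auto.
    by case=> [/EW//|zb']; apply: (abs _ _ z clW).
have DWE : D `&` W = D `&` closure W.
  apply/seteqP; split=> z [Dz Wz]; split=> //; first exact: subset_closure.
  by apply: contrapT => nWz; apply: (abs _ _ z DW).
have QW : Q `<=` D `&` W.
  apply: bigcap_inf; split; last by split => //; exact: EW.
  split; first exact: openI.
  by rewrite DWE; apply: closedI => //; exact: closed_closure.
have [z Ez] := E0 (~~ b); have Qz : Q z.
  by rewrite QE; case: (b) Ez => /=; [left|right].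
apply: (abs _ _ z clW _ Ez); apply: subset_closure.
by have [] := QW z Qz.
Qed.

End CompactSpaces.

Section Profinite.
Variables (G : topGroupType) (Gp : profinite G).

Lemma continuousMg (T : topologicalType) (f g : T -> G) :
  continuous f -> continuous g -> continuous (fun x => f x * g x)%g.
Proof.
move=> cf cg x; apply: (@continuous_comp _ _ _ (fun x => (f x, g x))
  (fun y : G * G => (y.1 * y.2)%g)); last exact: mulg_continuous.
by apply: cvg_pair; [exact: cf|exact: cg].
Qed.

Lemma continuousVg (T : topologicalType) (f : T -> G) :
  continuous f -> continuous (fun x => (f x)^-1)%g.
Proof.
move=> cf x; apply: (@continuous_comp _ _ _ f (fun y : G => y^-1%g)).
  exact: cf.
exact: invg_continuous.
Qed.

Lemma open_subgroup (N : set G) : subgroup N -> nbhs 1%g N -> open N.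
Proof.
move=> sN N1; rewrite openE => g Ng; rewrite /interior.
have : nbhs g ((fun x => g^-1 * x)%g @^-1` N).
  apply: (mulgl_continuous (g := g^-1%g)).
  by rewrite mulVg.
apply: filterS => x /= Nx.
by rewrite -[x]mul1g -(mulgV g) -mulgA; apply: subgroupM.
Qed.

(* For [D] clopen in [W], the largest normal subgroup of which [D] is a union of
   cosets is open by compactness of [G * G]. *)
Lemma open_normal_basis (W : set G) : nbhs 1%g W ->
  exists U : open_normal G, onset U `<=` W.
Proof.
have [cG hG tdG] := Gp; move=> W1.
have zG := compact_zero_dimensional cG hG tdG.
have [D [D1 [oD cD]] DW] := zero_dimensional_cvg (x := 1%g) hG zG cG W1.
pose N := [set g | forall a b, D (a * b)%g <-> D (a * g * b)%g].
have sN : subgroup N.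
  split=> [a b|g h Ng Nh a b|g Ng a b]; first by rewrite mulg1.
    by rewrite (Nh a b); have := Ng a (h * b)%g; rewrite !mulgA.
  by have := Ng (a * g^-1)%g b; rewrite mulgVK => ->.
have nN g h : N h -> N (g * h * g^-1)%g.
  move=> Nh a b; have := Nh (a * g)%g (g^-1 * b)%g.
  by rewrite !mulgA mulgK.
have cGG : compact [set: G * G] by rewrite -setXTT; apply: compact_setX.
pose P (g : G) (y : G * G) : Prop := D (y.1 * y.2)%g <-> D (y.1 * g * y.2)%g.
have PD (x : G * G) : \forall y \near x & g \near (1%g : G), P g y.
  pose p1 (z : G * G * G) := (z.1.1 * z.1.2)%g.
  pose p2 (z : G * G * G) := (z.1.1 * z.2 * z.1.2)%g.
  have c1 : continuous (fun z : G * G * G => z.1.1).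
    by move=> z; apply: continuous_comp; exact: cvg_fst.
  have c2 : continuous (fun z : G * G * G => z.1.2).
    by move=> z; apply: continuous_comp; [exact: cvg_fst|exact: cvg_snd].
  have c3 : continuous (fun z : G * G * G => z.2) by move=> z; exact: cvg_snd.
  have cp1 : continuous p1 by exact: continuousMg.
  have cp2 : continuous p2 by apply: continuousMg => //; exact: continuousMg.
  have e12 : p2 (x, 1%g) = p1 (x, 1%g) by rewrite /p2 mulg1.
  change (nbhs (x, 1%g : G) [set z | P z.2 z.1]).
  have nb (B : set G) : open B -> B (p1 (x, 1%g)) ->
      nbhs (x, 1%g : G) (p1 @^-1` B `&` p2 @^-1` B).
    move=> oB Bx; apply: filterI.
      by apply: cp1; apply: open_nbhs_nbhs.
    by apply: cp2; rewrite -/(p2 _) e12; apply: open_nbhs_nbhs.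
  have [Dx|nDx] := pselect (D (p1 (x, 1%g))).
    by apply: filterS (nb _ oD Dx) => z [].
  by apply: filterS (nb _ (closed_openC cD) nDx) => z [].
have N1 : nbhs 1%g N.
  (* [PD] gives a neighbourhood of 1 depending on the point of [G * G]; compactness makes it
     uniform. *)
  have := (compact_near_coveringP _).1 cGG G (nbhs (1%g : G)) P _.
  move=> /(_ _ (fun x _ => PD x)); apply: filterS => g Pg a b.
  exact: (Pg (a, b) I).
exists (OpenNormal (open_subgroup sN N1) sN nN) => g /= Ng.
by apply: DW; have := Ng 1%g 1%g; rewrite !mulg1 mul1g => -[/(_ D1)].
Qed.

End Profinite.

(** * The reciprocity map on cocycles *)

Section OpenDerived.
Variable G : topGroupType.

Lemma open_normalI_proof (U V : open_normal G) :
  [/\ open (onset U `&` onset V), subgroup (onset U `&` onset V) &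
      forall g h, (onset U `&` onset V) h ->
        (onset U `&` onset V) (g * h * g^-1)%g].
Proof.
have [sU sV] := (onset_subgroup U, onset_subgroup V).
split; first by apply: openI; apply: onset_open.
  split=> [|x y [Ux Vx] [Uy Vy]|x [Ux Vx]]; split; try exact: subgroup1;
  try exact: subgroupM; exact: subgroupV.
by move=> g h [Uh Vh]; split; apply: onset_normal.
Qed.

Definition open_normalI (U V : open_normal G) : open_normal G :=
  let: And3 oUV sUV nUV := open_normalI_proof U V in OpenNormal oUV sUV nUV.

Lemma open_normalIE U V : onset (open_normalI U V) = onset U `&` onset V.
Proof. by rewrite /open_normalI; case: open_normalI_proof. Qed.

Variable H : open_normal G.

(** For [U] normal and inside [H], this is the preimage in [H] of the commutator subgroup of
    [H/U]. *)
Definition open_derived (U : set G) (x : G) : Prop :=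
  forall N : set G, subgroup N -> U `<=` N ->
    (forall h k, onset H h -> onset H k -> N [~ h, k]%g) -> N x.

Lemma open_derived_subgroup U : subgroup (open_derived U).
Proof.
split=> [N sN _ _|x y Dx Dy N sN UN cN|x Dx N sN UN cN].
- exact: subgroup1.
- by apply: subgroupM => //; [apply: Dx|apply: Dy].
- by apply: subgroupV => //; apply: Dx.
Qed.

Lemma open_derived_closed (U : open_normal G) : closed (open_derived U).
Proof.
apply: open_subgroup_closed; first exact: open_derived_subgroup.
apply: open_subgroup; first exact: open_derived_subgroup.
have U1 := open_nbhs_nbhs (conj (onset_open U) (subgroup1 (onset_subgroup U))).
by apply: filterS U1 => x Ux N _ UN _; apply: UN.
Qed.

Lemma open_derivedS (U V : set G) : U `<=` V -> open_derived U `<=` open_derived V.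
Proof.
by move=> UV x Dx N sN VN; apply: Dx => // y Uy; apply: VN; apply: UV.
Qed.

(** If [x] is outside a closed subgroup [N], then [x V] misses [N] for some open normal [V]. With
    [U] the intersection of [V] and [H], the subgroup [N U] contains [U] and the commutators but not
    [x]. *)
Lemma closed_derivedP : profinite G -> forall x,
  (forall U : open_normal G, onset U `<=` onset H -> open_derived U x) ->
  closed_derived H x.
Proof.
move=> Gp x Dx N cN sN NH; apply: contrapT => nNx.
have W1 : nbhs 1%g ((fun g => x * g)%g @^-1` ~` N).
  apply: (mulgl_continuous (g := x)); rewrite mulg1.
  by apply: open_nbhs_nbhs; split=> //; apply: closed_openC.
have [V VW] := open_normal_basis Gp W1.
pose U := open_normalI V H.
have UV : onset U `<=` onset V by rewrite open_normalIE => y [].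
have UH : onset U `<=` onset H by rewrite open_normalIE => y [].
have sU := onset_subgroup U.
pose NU := [set y | exists2 n, N n & onset U (n^-1 * y)%g].
have [||h k Hh Hk|n Nn Un] := Dx U UH NU.
- split=> [|y z [n Nn Uy] [m Nm Uz]|y [n Nn Uy]].
  + exists 1%g; first exact: subgroup1.
    by rewrite mulg1 invg1; apply: subgroup1.
  + exists (n * m)%g; first exact: subgroupM.
    rewrite (_ : (n * m)^-1 * (y * z) =
      m^-1 * (n^-1 * y) * m^-1^-1 * (m^-1 * z))%g.
      by apply: subgroupM => //; apply: onset_normal.
    by rewrite invgM invgK !mulgA mulgK.
  + exists n^-1%g; first exact: subgroupV.
    rewrite invgK (_ : n * y^-1 = n * (n^-1 * y)^-1 * n^-1)%g.
      by apply: onset_normal; apply: subgroupV.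
    by rewrite invgM invgK mulgA mulgK.
- move=> y Uy; exists 1%g; first exact: subgroup1.
  by rewrite invg1 mul1g.
- exists [~ h, k]%g; first exact: NH.
  by rewrite mulVg; apply: subgroup1.
apply: (VW (n^-1 * x)^-1%g).
  by apply: subgroupV (onset_subgroup V) _ _; apply: UV.
by rewrite /= invgM invgK mulgA mulgV mul1g.
Qed.

(** The elements of [N] in [H] have as image in [H/U] a subgroup containing all commutators. *)
Lemma derived_open (U : open_normal G) (UH : onset U `<=` onset H) x :
  onset H x -> derived (cls (sub_section UH) x) -> open_derived U x.
Proof.
move=> Hx dx N sN UN cN.
have sH := onset_subgroup H.
have [|x1 x2|n [Nn Hn]] := dx [set q | exists2 n, N n /\ onset H n & q = cls _ n].
- split=> [|_ _ [n [Nn Hn] ->] [m [Nm Hm] ->]|_ [n [Nn Hn] ->]].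
  + by exists 1%g; [split; apply: subgroup1|].
  + by exists (n * m)%g; [split; apply: subgroupM|rewrite clsM].
  + by exists n^-1%g; [split; apply: subgroupV|rewrite clsV].
- have [h Hh ->] : exists2 h, onset H h & x1 = cls _ h := quotE x1.
  have [k Hk ->] : exists2 k, onset H k & x2 = cls _ k := quotE x2.
  have HV y : onset H y -> onset H y^-1%g by exact: subgroupV.
  have HM y z : onset H y -> onset H z -> onset H (y * z)%g by exact: subgroupM.
  exists [~ h, k]%g; first split; first exact: cN.
    by rewrite /commg /conjg; do ![apply: (HM) => //|apply: (HV) => //].
  rewrite /commg /conjg !clsV // !clsM //;
  by do ![apply: (HM) => //|apply: (HV) => //].
move=> /cls_eqP => /(_ Hx Hn) /= e.
rewrite -[x]invgK -[x^-1%g]mulg1 -(mulgV n) mulgA.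
by apply: subgroupV => //; apply: subgroupM; [|exact: UN|exact: subgroupV].
Qed.

End OpenDerived.

(** * Equivariance of reciprocity, and passage to the limit *)

Section ReciprocityCocycle.
Variables (G : topGroupType) (C : class_formation G) (H : open_normal G).
Variables (rec : fixpts C H -> profinite_ab H) (recP : reciprocity rec).
Hypothesis Gp : profinite G.
Let Gam : groupType := quot (full_section H).
Let MG := fixmod C (full_section H).
Variables (a : Gam -> Gam -> MG) (beta : Gam -> MG).
Hypothesis aE : forall x y, a x y = inhom2 (fund C (full_section H)) x y +
  (beta x + act x (beta y) - beta (x * y)%g).
Hypothesis a1l : forall y, a 1%g y = 0.
Hypothesis a1r : forall y, a y 1%g = 0.

Let sH := onset_subgroup H.
Let HV x : onset H x -> onset H x^-1%g.
Proof. exact: subgroupV. Qed.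
Let HM x y : onset H x -> onset H y -> onset H (x * y)%g.
Proof. exact: subgroupM. Qed.

Lemma ab_classP (x : profinite_ab H) : exists2 h, onset H h & x = ab_class H h.
Proof. by have [h Hh ->] := quotE x; exists h. Qed.

Let rel_rec U (UH : onset U `<=` onset H) c h :
  onset H h -> rec c = ab_class H h -> level_rel UH h^-1%g c.
Proof. exact: level_rel_reciprocity. Qed.

Let rel_recN U (UH : onset U `<=` onset H) c h :
  onset H h -> rec c = ab_class H h -> level_rel UH h (- c).
Proof.
by move=> Hh ch; rewrite -[h]invgK; apply: level_relV; [exact: HV|exact: rel_rec].
Qed.

Let rel_derived x :
  onset H x -> (forall (U : open_normal G) (UH : onset U `<=` onset H),
    level_rel (C := C) UH x 0) -> closed_derived H x.
Proof.
move=> Hx rx; apply: closed_derivedP => // U UH.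
exact: derived_open (level_rel0 Hx (rx U UH)).
Qed.

(** The hypothesis on [rec] concerns each level separately. The defect of additivity is related to 0
    at every level, hence lies in the closed commutator subgroup by injectivity of the Nakayama
    maps. *)
Lemma rec_add c d : rec (c + d) = (rec c * rec d)%g.
Proof.
have [h Hh ch] := ab_classP (rec c); have [k Hk dk] := ab_classP (rec d).
have [l Hl cdl] := ab_classP (rec (c + d)).
rewrite ch dk cdl /ab_class -clsM //; apply/cls_eqP => //; first exact: HM.
apply: rel_derived => [|U UH]; first by apply: HM; [exact: HV|exact: HM].
rewrite (_ : 0 = (c + d) + (- c - d)); last by zmod.
apply: level_relM (rel_rec UH Hl cdl) _; [exact: HV|exact: HM|].
exact: level_relM (rel_recN UH Hh ch) (rel_recN UH Hk dk).
Qed.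

Lemma rec_act g (c : MG) h : onset H h -> rec c = ab_class H h ->
  rec (act (cls (full_section H) g) c : MG) = ab_class H (g * h * g^-1)%g.
Proof.
move=> Hh ch; set d : MG := act _ c.
have [l Hl dl] := ab_classP (rec d).
have Hgh := onset_normal g Hh.
rewrite dl; apply/cls_eqP => //; apply: rel_derived => [|U UH].
  by apply: HM; [exact: HV|].
rewrite (_ : 0 = d + - d); last by zmod.
apply: level_relM (rel_rec UH Hl dl) _; [exact: HV|exact: Hgh|].
have := level_rel_act aE a1l a1r g Hh (rel_recN UH Hh ch).
by rewrite (is_additiveN (act_additive _)).
Qed.

Variable R : G -> G -> G.
Hypothesis HR : forall s t, onset H (R s t).
Hypothesis recR : forall s t, rec (a (cls _ s) (cls _ t)) = ab_class H (R s t).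

(** A representative in [H] of the coboundary of [n] plus [rec] of [a], written multiplicatively. *)
Let word (n : G -> G) (s t : G) : G :=
  (n s * (s * n t * s^-1) * (n (s * t))^-1 * R s t)%g.

(** [D] is the tolerated error; for closed [D] the condition is closed in the product space
    [G^G]. *)
Let solution (D : set G) (n : G -> G) : Prop :=
  [/\ forall g, onset H (n g), forall h, onset H h -> D (n h * h)%g
    & forall s t, D (word n s t)].

Let level_solution (U : open_normal G) (UH : onset U `<=` onset H) :
  exists n, solution (open_derived H U) n.
Proof.
have [nu [nuM nuH]] := level_lift UH aE a1l a1r.
pose n g := s2val (cid2 (ab_classP (rec (nu g)))).
have Hn g : onset H (n g) := s2valP (cid2 (ab_classP (rec (nu g)))).
have recn g : rec (nu g) = ab_class H (n g).
  exact: s2valP' (cid2 (ab_classP (rec (nu g)))).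
have sD := open_derived_subgroup H U.
exists n; split=> // [h Hh|s t].
  apply: (@derived_open _ _ _ UH); first exact: HM.
  apply: (level_rel0 (C := C)); first exact: HM.
  rewrite (_ : 0 = - nu h + nu h); last by zmod.
  exact: level_relM (Hn h) Hh (rel_recN UH (Hn h) (recn h)) (nuH h Hh).
have Hs := onset_normal s (HV (Hn t)).
have rt := level_rel_act aE a1l a1r s (HV (Hn t)) (rel_rec UH (Hn t) (recn t)).
have Hw : onset H (word n s t).
  by do 2?[apply: HM => //]; [apply: HM => //; apply: onset_normal|apply: HV].
(* The inverse word is treated because [rel_rec] relates [c] to the inverse of a representative of
   [rec c]. *)
rewrite -[word n s t]invgK; apply: (subgroupV sD).
apply: (@derived_open _ _ _ UH); first exact: HV.
apply: (level_rel0 (C := C)); first exact: HV.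
have H1 := subgroup1 sH.
pose st := (s * t)%g; set v := (s * (n t)^-1 * s^-1)%g in Hs rt.
have r1 := level_relM (HV (HR s t)) (Hn st)
  (rel_rec UH (HR s t) (recR s t)) (rel_recN UH (Hn st) (recn st)).
have r2 := level_relM Hs (HV (Hn s)) rt (rel_rec UH (Hn s) (recn s)).
have r3 := level_relM (HM (HV (HR s t)) (Hn st)) (HM Hs (HV (Hn s))) r1 r2.
have := level_relM (HM (HM (HV (HR s t)) (Hn st)) (HM Hs (HV (Hn s)))) (HV H1)
  r3 (level_relV H1 (nuM s t)).
congr level_rel; last by zmod.
by rewrite /word !invgM !invgK invg1 mulg1 !mulgA.
Qed.

(** The solutions modulo the various [U] form nonempty closed sets, directed because [U] may be
    shrunk; a common point solves modulo every [U], and [closed_derivedP] concludes. *)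
Lemma rec_cocycle : exists n : G -> G,
  [/\ forall g, onset H (n g),
      forall h, onset H h -> closed_derived H (n h * h)%g
    & forall s t, closed_derived H
        (n s * (s * n t * s^-1) * (n (s * t))^-1 * R s t)%g].
Proof.
pose D := [set S : set (G -> G) | exists2 U : open_normal G,
  onset U `<=` onset H & S = solution (open_derived H U)].
have cGG : compact [set: {ptws G -> G}].
  have [cG _ _] := Gp; have := @tychonoff G (fun=> G) (fun=> setT) (fun=> cG).
  by congr compact; apply/seteqP; split.
have ev g : continuous (fun n : {ptws G -> G} => n g).
  exact: (@proj_continuous G (fun=> G) g).
have cst (g : G) : continuous (fun _ : {ptws G -> G} => g).
  exact: cst_continuous.
have [||S T [U UH ->] [V VH ->]|n nP] := @compact_directed _ cGG D.
- by exists (solution (open_derived H H)), H.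
- move=> _ [U UH ->]; split; last exact: level_solution.
  have cD := @open_derived_closed G H U.
  have cH := @open_subgroup_closed G H sH (@onset_open G H).
  rewrite (_ : solution _ = (\bigcap_(g in setT) ((fun n => n g) @^-1` onset H))
    `&` (\bigcap_(h in onset H) ((fun n => n h * h)%g @^-1` open_derived H U))
    `&` (\bigcap_(p in setT) ((fun n => word n p.1 p.2) @^-1` open_derived H U))).
    apply: closedI; first apply: closedI; apply: closed_bigI => x _.
    + by apply: preimage_closed => // n _; apply: ev.
    + apply: preimage_closed => // n _.
      exact: continuousMg (ev x) (cst x) n.
    + apply: preimage_closed => // n _.
      have c1 := continuousMg (continuousMg (cst x.1) (ev x.2)) (cst x.1^-1%g).
      have c2 := continuousMg (continuousMg (ev x.1) c1)
        (continuousVg (ev (x.1 * x.2)%g)).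
      exact: continuousMg c2 (cst (R x.1 x.2)) n.
  apply/seteqP; split=> [n [n1 n2 n3]|n [[n1 n2] n3]].
    by do ![split] => //= x _; [exact: n1|exact: n3].
  by split=> [g|h Hh|s t]; [exact: n1|exact: n2|exact: (n3 (s, t))].
- exists (solution (open_derived H (open_normalI U V))).
    by exists (open_normalI U V) => //; rewrite open_normalIE => x [/UH].
  by move=> n [n1 n2 n3]; split; split=> // *;
     (apply: open_derivedS; last by eauto); rewrite open_normalIE => x [].
have nU (U : open_normal G) : onset U `<=` onset H -> solution (open_derived H U) n.
  by move=> UH; apply: nP; exists U.
exists n; split=> [g|h Hh|s t].
- by have [] := nU H (@subset_refl _ _).
- by apply: closed_derivedP => // U UH; have [_ + _] := nU U UH; apply.
- by apply: closed_derivedP => // U UH; have [_ _] := nU U UH; apply.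
Qed.

End ReciprocityCocycle.

(** * The module [E(G/H)] *)

Section ExtensionCocycle.
Variables (Gam : groupType) (M : gmod Gam) (f : cochain M 2) (X : extension2 f).

Lemma extension_cocycle :
  exists (e : Gam -> X) (a : Gam -> Gam -> M) (b : Gam -> M),
  [/\ forall s, ext_out (e s) = << s >> - << 1%g >>,
      e 1%g = 0,
      forall s t, e s + act s (e t) = e (s * t)%g + ext_in X (a s t)
    & forall s t, a s t = inhom2 f s t + (b s + act s (b t) - b (s * t)%g)].
Proof.
have [inD ineq] := ext_in_hom X; have [outD outeq] := ext_out_hom X.
have [u [v [w [[ueq u1] [veq vout] wE wf]]]] := ext_class X.
have [b bE] := inhom2_cohomologous wf.
pose u0 := u (fun=> 1%g).
have [y yE] : exists y : X, ext_out y = u0 - << 1%g >>.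
  by apply: (ext_exact_aug X _).1; rewrite degB u1 degU subrr.
pose w0 := w (tnth [tuple 1; 1; 1]%g).
(* Subtracting the coboundary of [y] moves the base point from [u0] to [<< 1 >>]; subtracting [w0],
   whose image is [v(1, 1)], makes [e 1 = 0]. *)
pose e s := v (tnth [tuple 1; s]%g) - (act s y - y) - ext_in X w0.
exists e, (fun s t => inhom2 w s t - act s w0), (fun s => b s - w0); split.
- move=> s; rewrite /e !(is_additiveB outD) vout cobd0E outeq yE !(tnth_nth 1%g) /=.
  have -> : ext_out (ext_in X w0) = 0 by apply/ext_exact; exists w0.
  rewrite (_ : u (fun=> s) = act s u0); last first.
    by rewrite -ueq //; congr u; apply/funext => k; rewrite mulg1.
  rewrite -/u0 (is_additiveB (zactD s)) zactU mulg1 /=.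
  by zmod.
- by rewrite /e act1 wE cobd1E; zmod.
- move=> s t; rewrite /e !(is_additiveB (act_additive s)) (is_additiveB inD).
  rewrite -(veq s _ I) mul_tnth2 mulg1 ineq actM /inhom2 wE cobd1E.
  by zmod.
- move=> s t; rewrite bE (is_additiveB (act_additive s)).
  by zmod.
Qed.

End ExtensionCocycle.

(** * Submodules and coinduced modules *)

Record submodule (Gam : groupType) (N : gmod Gam) := Submodule {
  smset : set N;
  smset0 : smset 0;
  smsetB : forall x y, smset x -> smset y -> smset (x - y);
  smset_act : forall g x, smset x -> smset (act g x)
}.

Record smtype (Gam : groupType) (N : gmod Gam) (S : submodule N) := Smtype {
  smval :> N;
  _ : `[< smset S smval >]
}.

HB.instance Definition _ Gam (N : gmod Gam) S := [isSub for @smval Gam N S].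
HB.instance Definition _ Gam (N : gmod Gam) (S : submodule N) :=
  [Choice of smtype S by <:].

Lemma submodule_zmod_closed (Gam : groupType) (N : gmod Gam) (S : submodule N) :
  zmod_closed (fun x : N => `[< smset S x >]).
Proof.
split=> [|x y /asboolP Sx /asboolP Sy]; apply/asboolP; first exact: smset0.
exact: smsetB.
Qed.

HB.instance Definition _ Gam (N : gmod Gam) (S : submodule N) :=
  GRing.SubChoice_isSubZmodule.Build N _ (smtype S) (submodule_zmod_closed S).

Section SubmoduleModule.
Variables (Gam : groupType) (N : gmod Gam) (S : submodule N).

Lemma smact_proof g (x : smtype S) : `[< smset S (act g (smval x)) >].
Proof. by case: x => x /= /asboolP Sx; apply/asboolP/smset_act. Qed.

Definition smact g (x : smtype S) : smtype S := Smtype (smact_proof g x).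

Lemma smact1 x : smact 1%g x = x.
Proof. by apply: val_inj; apply: act1. Qed.

Lemma smactM g h x : smact (g * h)%g x = smact g (smact h x).
Proof. by apply: val_inj; apply: actM. Qed.

Lemma smactD g x y : smact g (x + y) = smact g x + smact g y.
Proof. by apply: val_inj; apply: actD. Qed.

Definition smgmod : gmod Gam := Gmod smact1 smactM smactD.

End SubmoduleModule.

Section Coinduced.
Variables (Gam : groupType) (A : zmodType).

Definition coind_act (g : Gam) (p : Gam -> A) : Gam -> A := fun x => p (x * g)%g.

Lemma coind_act1 p : coind_act 1%g p = p.
Proof. by apply/funext => x; rewrite /coind_act mulg1. Qed.

Lemma coind_actM g h p : coind_act (g * h)%g p = coind_act g (coind_act h p).
Proof. by apply/funext => x; rewrite /coind_act mulgA. Qed.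

Lemma coind_actD g p r : coind_act g (p + r) = coind_act g p + coind_act g r.
Proof. by []. Qed.

Definition coind : gmod Gam := Gmod coind_act1 coind_actM coind_actD.

End Coinduced.

(** * Generation and exactness of the pushout *)

Section PushoutModule.
Variables (G : topGroupType) (C : class_formation G) (H : open_normal G).
Variables (X : extension2 (fund C (full_section H))).
Variables (rec : fixpts C H -> profinite_ab H).
Variable (E : pushout_module X rec).
Let Gam : groupType := quot (full_section H).
Let sH := onset_subgroup H.
Let j : profinite_ab H -> E := @po_ab _ _ _ _ _ E.
Let q : X -> E := @po_ext _ _ _ _ _ E.
Let EG : gmod Gam := gmod_of_tmod E.

Lemma po_abM a b : j (a * b)%g = j a + j b.
Proof. exact: cocone_mul (po_cocone E) a b. Qed.

Lemma po_ab1 : j 1%g = 0.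
Proof. by apply: (addrI (j 1%g)); rewrite -po_abM mulg1 addr0. Qed.

Lemma po_abV a : j a^-1%g = - j a.
Proof. by apply: (addrI (j a)); rewrite -po_abM mulgV po_ab1 subrr. Qed.

Lemma po_ab_conj g h : onset H h ->
  j (ab_class H (g * h * g^-1)%g) = tact (cls _ g) (j (ab_class H h)).
Proof. exact: (cocone_conj (po_cocone E)). Qed.

Lemma po_extD : is_additive q.
Proof. exact: (cocone_hom (po_cocone E)).1. Qed.

Lemma po_ext_act s x : q (act s x) = tact s (q x).
Proof. exact: (cocone_hom (po_cocone E)).2. Qed.

Lemma po_ext_in c : q (ext_in X c) = j (rec c).
Proof. exact: (cocone_comm (po_cocone E)). Qed.

(* [E -> S -> E], where [S] is the submodule of these elements, is the identity
   by the uniqueness of maps out of a pushout. *)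
Lemma po_span e : exists a x, e = j a + q x.
Proof.
pose P : set EG := [set e | exists a x, e = j a + q x].
have P0 : P 0.
  by exists 1%g, 0; rewrite po_ab1 (is_additive0 po_extD) addr0.
have PB x y : P x -> P y -> P (x - y).
  move=> [a [m ->]] [b [n ->]]; exists (a * b^-1)%g, (m - n).
  by rewrite po_abM po_abV (is_additiveB po_extD); zmod.
have PA s x : P x -> P (act s x).
  move=> [a [m ->]]; have [g _ ->] := quotE s.
  have [h Hh ->] := ab_classP a.
  exists (ab_class H (g * h * g^-1)%g), (act (cls _ g) m).
  by rewrite po_ab_conj // po_ext_act; apply: tactD.
pose S := Submodule P0 PB PA.
have jP a : `[< smset S (j a) >].
  by apply/asboolP; exists a, 0; rewrite (is_additive0 po_extD) addr0.
have qP x : `[< smset S (q x) >].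
  by apply/asboolP; exists 1%g, x; rewrite po_ab1 add0r.
have cone : @is_cocone G C H X rec (smgmod S)
    (fun a => Smtype (jP a)) (fun x => Smtype (qP x)).
  split.
  - by move=> a b; apply: val_inj; apply: po_abM.
  - by move=> g h Hh; apply: val_inj; apply: po_ab_conj.
  - split=> [x y|s x]; apply: val_inj; [exact: po_extD|exact: po_ext_act].
  - by move=> c; apply: val_inj; apply: po_ext_in.
have [r [[[rD req] rj rq] _]] := po_universal E cone.
have [i [_ iu]] := po_universal E (po_cocone E).
have i1 : i = fun x => x by apply: iu; split.
have i2 : i = fun x => smval (r x).
  apply: iu; split=> [|a|x]; last 2 first.
  - by rewrite rj.
  - by rewrite rq.
  by split=> [x y|s x]; rewrite ?rD ?req.
have -> : e = smval (r e) by rewrite -[LHS](congr1 (fun i => i e) i1) i2.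
by case: (r e) => x /= /asboolP.
Qed.

Lemma po_out_kernel e : po_out E e = 0 -> exists a, e = j a.
Proof.
have [a [x ->]] := po_span e.
rewrite (po_out_hom E).1 po_out_ab po_out_ext add0r => /ext_exact[m mx].
by exists (a * rec m)%g; rewrite po_abM -po_ext_in mx.
Qed.

Lemma po_out_deg e : deg (po_out E e) = 0.
Proof.
have [a [x ->]] := po_span e.
rewrite (po_out_hom E).1 po_out_ab po_out_ext add0r.
by apply/ext_exact_aug; exists x.
Qed.

End PushoutModule.

(** By additivity, [L z] is [z] minus [deg z] copies of [t0]. Hence lifts of the
    [<< t >> - << t0 >>] extend to an additive section in degree 0. *)
Lemma freeg_deg0 (T : choiceType) (t0 : T) (L : {freeg T} -> {freeg T}) :
  is_additive L -> (forall t, L << t >> = << t >> - << t0 >>) ->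
  forall z, deg z = 0 -> L z = z.
Proof.
move=> LD LE; suff Lz z : L z = z - << deg z *g t0 >>.
  by move=> z z0; rewrite Lz z0 freegU0 subr0.
have zD : is_additive (fun z : {freeg T} => z - << deg z *g t0 >>).
  by move=> x y /=; rewrite degD -freegUD; zmod.
apply: (zadd_ext LD zD) => k t /=.
have kU u : << k *g u >> = (<< u >> : {freeg T}) *~ k by rewrite freegU_mulz intz.
by rewrite degU !kU (is_additiveMz LD) LE mulrzBl.
Qed.

Lemma zlin1 (T : choiceType) (M : zmodType) (f : T -> M) t : zlin f << t >> = f t.
Proof. by rewrite zlinU mulr1z. Qed.

(** * The Shafarevich-Weil cocycle *)

Section FundamentalCocycle.
Variables (G : topGroupType) (Gp : profinite G) (C : class_formation G).
Variables (H : open_normal G) (X : extension2 (fund C (full_section H))).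
Variables (rec : fixpts C H -> profinite_ab H) (recP : reciprocity rec).
Variable (E : pushout_module X rec).
Let Gam : groupType := quot (full_section H).
Let MG := fixmod C (full_section H).
Let pcls : G -> Gam := cls (full_section H).
Let sH := onset_subgroup H.
Let j : profinite_ab H -> E := @po_ab _ _ _ _ _ E.
Let q : X -> E := @po_ext _ _ _ _ _ E.

Let HV x : onset H x -> onset H x^-1%g.
Proof. exact: subgroupV. Qed.
Let HM x y : onset H x -> onset H y -> onset H (x * y)%g.
Proof. exact: subgroupM. Qed.

Lemma ab_classM h k : onset H h -> onset H k ->
  ab_class H (h * k)%g = (ab_class H h * ab_class H k)%g.
Proof. by move=> Hh Hk; rewrite /ab_class clsM. Qed.

Lemma po_ab_derived x : closed_derived H x -> j (ab_class H x) = 0.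
Proof. by move=> Dx; rewrite /ab_class cls_bot // /j po_ab1. Qed.

Lemma po_ab_classM h k : onset H h -> onset H k ->
  j (ab_class H (h * k)%g) = j (ab_class H h) + j (ab_class H k).
Proof. by move=> Hh Hk; rewrite ab_classM // /j po_abM. Qed.

Lemma po_ab_classV h : onset H h -> j (ab_class H h^-1%g) = - j (ab_class H h).
Proof. by move=> Hh; rewrite -po_abV /ab_class clsV. Qed.

Section Normalized.
Variables (e : Gam -> X) (a : Gam -> Gam -> MG) (b : Gam -> MG).
Hypothesis e_out : forall s, ext_out (e s) = << s >> - << 1%g >>.
Hypothesis e1 : e 1%g = 0.
Hypothesis eM : forall s t, e s + act s (e t) = e (s * t)%g + ext_in X (a s t).
Hypothesis aE : forall s t, a s t =
  inhom2 (fund C (full_section H)) s t + (b s + act s (b t) - b (s * t)%g).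

Let inD : is_additive (ext_in X) := (ext_in_hom X).1.

Let a1l s : a 1%g s = 0.
Proof.
apply: (ext_in_inj (e := X)); rewrite (is_additive0 inD).
by have := eM 1%g s; rewrite e1 act1 mul1g => h; zmod1 h.
Qed.

Let a1r s : a s 1%g = 0.
Proof.
apply: (ext_in_inj (e := X)); rewrite (is_additive0 inD).
by have := eM s 1%g; rewrite e1 act0 mulg1 => h; zmod1 h.
Qed.

(** Take [kap g = q (e g) + j (n g)]: the coboundary of [n] cancels the factor set [a] of [e],
    pushed out along [rec]. *)
Lemma cocycle_exists : exists kap : G -> E,
  [/\ forall s t, kap (s * t)%g = kap s + tact (pcls s) (kap t),
      forall h, onset H h -> kap h = - j (ab_class H h)
    & forall g, po_out E (kap g) = << pcls g >> - << 1%g >>].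
Proof.
have RP s t : {r | onset H r /\ rec (a (pcls s) (pcls t)) = ab_class H r}.
  by apply: cid; have [r Hr er] := ab_classP (rec (a (pcls s) (pcls t))); exists r.
pose R s t := sval (RP s t).
have HR s t : onset H (R s t) := (svalP (RP s t)).1.
have recR s t : rec (a (pcls s) (pcls t)) = ab_class H (R s t).
  exact: (svalP (RP s t)).2.
have [n [Hn nH nM]] := rec_cocycle recP Gp aE a1l a1r HR recR.
have jnM s t : j (ab_class H (n s)) + tact (pcls s) (j (ab_class H (n t))) +
    j (ab_class H (R s t)) = j (ab_class H (n (s * t)%g)).
  have := po_ab_derived (nM s t) => /=.
  have Hc := onset_normal s (Hn t).
  have p1 := HM (Hn s) Hc; have p2 := HM p1 (HV (Hn (s * t)%g)).
  rewrite (po_ab_classM p2 (HR s t)) (po_ab_classM p1 (HV (Hn _))).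
  rewrite (po_ab_classM (Hn s) Hc) po_ab_classV // /j po_ab_conj // -/j => h.
  by zmod1 h.
exists (fun g => q (e (pcls g)) + j (ab_class H (n g))); split.
- move=> s t; rewrite tactD.
  have := congr1 q (eM (pcls s) (pcls t)).
  rewrite /q !(po_extD E) po_ext_in po_ext_act recR /pcls -clsM // => h1.
  by have h2 := jnM s t; zmod2 h1 h2.
- move=> h Hh; rewrite /pcls (cls_bot (s := full_section H) Hh) e1.
  rewrite /q (is_additive0 (po_extD E)) add0r.
  have := po_ab_derived (nH h Hh); rewrite po_ab_classM // => e2.
  by zmod1 e2.
- by move=> g; rewrite /j /q (po_out_hom E).1 po_out_ab po_out_ext e_out addr0.
Qed.

(* The universal property is applied to the coinduced module of [A]: a
   [Gam]-equivariant map into it is the same as an additive map into [A]. *)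
Lemma po_extend (A : zmodType) (c : G -> A) :
  (forall h k, onset H h -> onset H k -> c (h * k)%g = c h + c k) ->
  (forall h, closed_derived H h -> c h = 0) ->
  exists2 phi : E -> A, is_additive phi &
    forall h, onset H h -> phi (j (ab_class H h)) = c h.
Proof.
move=> cM cD.
have H1 : onset H 1%g := subgroup1 sH.
have c1 : c 1%g = 0 by apply: cD; apply: subgroup1 (closed_derived_subgroup H).
have cV h : onset H h -> c h^-1%g = - c h.
  by move=> Hh; have := cM h h^-1%g Hh (HV Hh); rewrite mulgV c1 => h1; zmod1 h1.
have cJ h k : onset H h -> onset H k -> c (h * k * h^-1)%g = c k.
  by move=> Hh Hk; rewrite (cM _ _ (HM Hh Hk) (HV Hh)) cM // cV //; zmod.
have cab h k : onset H h -> onset H k -> ab_class H h = ab_class H k -> c h = c k.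
  move=> Hh Hk /cls_eqP => /(_ Hh Hk) /cD; rewrite cM ?cV //; last exact: HV.
  by move=> h1; zmod1 h1.
pose c' (x : profinite_ab H) : A := c (qrepr x).
have c'E h : onset H h -> c' (ab_class H h) = c h.
  move=> Hh; apply: cab => //; first exact: (qrepr_top (s := ab_section H)).
  exact: qreprK.
have c'M x y : c' (x * y)%g = c' x + c' y.
  have [h Hh ->] := ab_classP x; have [k Hk ->] := ab_classP y.
  by rewrite -ab_classM // !c'E ?cM //; exact: HM.
(* The value at [s] is [c] of a conjugate by [s]; it does not depend on representatives, because [c]
   is invariant under conjugation by [H] and kills [closed_derived H]. *)
pose j' (x : profinite_ab H) : coind Gam A :=
  fun s => c' (ab_class H (qrepr s * qrepr x * (qrepr s)^-1)%g).
have j'E h g : onset H h -> j' (ab_class H h) (pcls g) = c (g * h * g^-1)%g.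
  move=> Hh; set r := qrepr (pcls g); set k := qrepr (ab_class H h).
  have Hk : onset H k by exact: (qrepr_top (s := ab_section H)).
  have Hr : onset H (g^-1 * r)%g by exact: (qrepr_cls (s := full_section H)).
  have Dk : closed_derived H (h^-1 * k)%g by exact: (qrepr_cls (s := ab_section H)).
  rewrite /j' c'E; last exact: onset_normal.
  rewrite (_ : r * k * r^-1 = (g * (g^-1 * r) * g^-1) * (g * k * g^-1) *
      (g * (g^-1 * r) * g^-1)^-1)%g; last first.
    by rewrite !invgM !invgK !mulgA mulgV !mul1g !mulgVK mulgK.
  rewrite cJ; [|exact: onset_normal|exact: onset_normal].
  rewrite (_ : g * k * g^-1 =
      (g * h * g^-1) * (g * (h^-1 * k) * g^-1))%g; last first.
    by rewrite !mulgA mulgVK mulgK.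
  rewrite cM; [|exact: onset_normal|]; last first.
    by apply: onset_normal; apply: closed_derived_sub.
  by rewrite (cD (g * (h^-1 * k) * g^-1)%g) ?addr0 //; apply: closed_derived_normal.
(* [zlin e] is an additive section of [ext_out] in degree 0, so [x - ell x] comes from [C^H]; this
   gives an additive retraction [m] of [X] onto [C^H]. *)
pose ell (x : X) : X := zlin e (ext_out x).
have outD : is_additive (@ext_out _ _ _ X) := (ext_out_hom X).1.
have ellP x : exists m, ext_in X m = x - ell x.
  apply/ext_exact; rewrite (is_additiveB outD) /ell.
  rewrite (@freeg_deg0 _ 1%g (fun z => ext_out (zlin e z : X))) ?subrr //.
  - by move=> z z'; rewrite zlinD outD.
  - by move=> s; rewrite zlin1 e_out.
  - by apply/ext_exact_aug; exists x.
pose m x := sval (cid (ellP x)).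
have mE x : ext_in X (m x) = x - ell x := svalP (cid (ellP x)).
have mD x y : m (x + y) = m x + m y.
  apply: (ext_in_inj (e := X)); rewrite inD !mE /ell outD zlinD.
  by zmod.
have m_in y : m (ext_in X y) = y.
  apply: (ext_in_inj (e := X)); rewrite mE /ell.
  have -> : ext_out (ext_in X y) = 0 by apply/ext_exact; exists y.
  by rewrite (is_additive0 (zlinD e)) subr0.
pose q' (x : X) : coind Gam A := fun s => c' (rec (m (act s x))).
have cone : @is_cocone G C H X rec (coind Gam A) j' q'.
  split.
  - move=> x y; apply/funext => s; have [g _ ->] := quotE s.
    have [h Hh ->] := ab_classP x; have [k Hk ->] := ab_classP y.
    rewrite -ab_classM //.
    rewrite [LHS]j'E; last exact: HM.
    rewrite [RHS](_ : _ =
      j' (ab_class H h) (pcls g) + j' (ab_class H k) (pcls g)) //.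
    rewrite !j'E // -cM; [|exact: onset_normal|exact: onset_normal].
    by rewrite !mulgA mulgVK.
  - move=> g h Hh; apply/funext => s; have [x _ ->] := quotE s.
    rewrite [LHS]j'E; last exact: onset_normal.
    rewrite [RHS](_ : _ = j' (ab_class H h) (pcls (x * g)%g)); last first.
      by rewrite /pcls clsM.
    by rewrite j'E // !invgM !mulgA.
  - split=> [x y|s x]; apply/funext => t.
      rewrite [RHS](_ : _ = q' x t + q' y t) //.
      by rewrite /q' actD mD (rec_add recP Gp) c'M.
    by rewrite [RHS](_ : _ = q' x (t * s)%g) // /q' actM.
  - move=> y; apply/funext => s; have [g _ ->] := quotE s.
    rewrite /q' -(ext_in_hom X).2 m_in.
    have [h Hh yh] := ab_classP (rec y).
    rewrite [in RHS]yh j'E // (rec_act recP Gp aE a1l a1r g Hh yh).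
    by rewrite c'E //; apply: onset_normal.
have [F [[[FD Feq] Fj Fq] _]] := po_universal E cone.
(* Evaluation at 1 turns the equivariant map into the coinduced module back into an additive map
   into [A]. *)
exists (fun x => F x 1%g) => [x y|h Hh]; first by rewrite FD.
by rewrite Fj -(cls1 (full_section H)) j'E // mul1g invg1 mulg1.
Qed.

End Normalized.

(** Values of [kap] at coset representatives account for the image in [Z[G/H]]; what remains lies in
    [H^ab], where [j (ab_class H h)] is [- kap h]. *)
Lemma generated_by_cocycle (kap : G -> E) :
  (forall h, onset H h -> kap h = - j (ab_class H h)) ->
  (forall g, po_out E (kap g) = << pcls g >> - << 1%g >>) ->
  forall x : E, exists z : {freeg G}, zlin kap z = x.
Proof.
move=> kapH kap_out x.
have outD := (po_out_hom E).1.
pose z := po_out E x; pose k (s : Gam) := kap (qrepr s).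
have [a xa] : exists a, x - zlin k z = j a.
  apply: po_out_kernel; rewrite (is_additiveB outD).
  rewrite (@freeg_deg0 _ 1%g (fun z => po_out E (zlin k z))) ?subrr //.
  - by move=> y y'; rewrite zlinD outD.
  - by move=> s; rewrite zlin1 kap_out /pcls qreprK.
  - exact: po_out_deg.
have [h Hh ah] := ab_classP a.
exists (zlin (fun s : Gam => << qrepr s >>) z - << h >>).
rewrite (is_additiveB (zlinD _)) zlin1 kapH // -ah -xa.
rewrite (@zadd_ext _ _ (fun y => zlin kap (zlin (fun s : Gam => << qrepr s >>) y))
  (zlin k)) => [||//|n s]; first by zmod.
- by move=> y y'; rewrite !zlinD.
- by move=> y y'; rewrite !zlinD.
by rewrite !zlinU (is_additiveMz (zlinD _)) zlin1.
Qed.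

End FundamentalCocycle.

(** * Continuous cocycles *)

Section Complexes.
Variables (G : topGroupType) (C : class_formation G) (H : open_normal G).
Variables (X : extension2 (fund C (full_section H))).
Variables (rec : fixpts C H -> profinite_ab H) (E : pushout_module X rec).
Let Gam : groupType := quot (full_section H).
Let pcls : G -> Gam := cls (full_section H).
Let j : profinite_ab H -> E := @po_ab _ _ _ _ _ E.
Let sH := onset_subgroup H.

Variable kap : G -> E.
Hypothesis kapM : forall s t, kap (s * t)%g = kap s + tact (pcls s) (kap t).
Hypothesis kapH : forall h, onset H h -> kap h = - j (ab_class H h).
Hypothesis kap_out : forall g, po_out E (kap g) = << pcls g >> - << 1%g >>.
Hypothesis extend : forall (A : zmodType) (c : G -> A),
  (forall h k, onset H h -> onset H k -> c (h * k)%g = c h + c k) ->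
  (forall h, closed_derived H h -> c h = 0) ->
  exists2 phi : E -> A, is_additive phi &
    forall h, onset H h -> phi (j (ab_class H h)) = c h.

Lemma tact_additive (A : tmod Gam) g : is_additive (@tact _ A g).
Proof. exact: tactD. Qed.

Lemma pcls_mulr g h : onset H h -> pcls (g * h)%g = pcls g.
Proof.
by move=> Hh; rewrite /pcls clsM // (cls_bot (s := full_section H) Hh) mulg1.
Qed.

Lemma tact_onset (A : tmod Gam) h (x : A) : onset H h -> tact (pcls h) x = x.
Proof. by move=> Hh; rewrite /pcls (cls_bot (s := full_section H) Hh) tact1. Qed.

Lemma onset_nbhs g : nbhs g [set x | onset H (g^-1 * x)%g].
Proof.
apply: (mulgl_continuous (g := g^-1%g)); rewrite mulVg.
by apply: open_nbhs_nbhs; split; [exact: onset_open|exact: subgroup1].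
Qed.

Lemma coset_continuous (T : topologicalType) (F : G -> T) :
  (forall g h, onset H h -> F (g * h)%g = F g) -> continuous F.
Proof.
move=> FH g O /= Og; apply: filterS (onset_nbhs g) => x /= Hx.
have -> : x = (g * (g^-1 * x))%g by rewrite mulgA mulgV mul1g.
by rewrite /= FH //; apply: nbhs_singleton.
Qed.

Lemma continuousD (T : topologicalType) (A : topologicalZmodType) (f g : T -> A) :
  continuous f -> continuous g -> continuous (fun x => f x + g x).
Proof.
move=> cf cg x; apply: (@continuous_comp _ _ _ (fun x => (f x, g x))
  (fun y : A * A => y.1 + y.2)); last exact: add_continuous.
by apply: cvg_pair; [exact: cf|exact: cg].
Qed.

Lemma continuousB (T : topologicalType) (A : topologicalZmodType) (f g : T -> A) :
  continuous f -> continuous g -> continuous (fun x => f x - g x).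
Proof.
move=> cf cg x; apply: (@continuous_comp _ _ _ (fun x => (f x, g x))
  (fun y : A * A => y.1 - y.2)); last exact: sub_continuous.
by apply: cvg_pair; [exact: cf|exact: cg].
Qed.

Lemma po_ab_open (B : set E) : open B ->
  open [set h : G | onset H h /\ B (j (ab_class H h))].
Proof.
move=> oB; apply: ((po_topology E [set a | B (j a)]).1).
have -> : [set j x | x in [set a | B (j a)]] = B `&` [set j x | x in setT].
  apply/seteqP; split=> [_ [x Bx <-]|e [Be [x _ xe]]].
    by split=> //; exists x.
  by exists x => //=; rewrite xe.
apply: openI => //; apply: ((po_topology E setT).2).
rewrite /ab_open (_ : [set h | _] = onset H); first exact: onset_open.
by apply/seteqP; split=> [h []|h].
Qed.

(** Near [g], write [x = g h] with [h] in [H]; then [kap x = kap g - g j(h)], and [j] is continuous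
    on [H] by the topology of [E]. *)
Lemma cocycle_continuous : continuous kap.
Proof.
move=> g O /= Og; pose tau (x : E) := kap g - tact (pcls g) x.
have ctau : continuous tau.
  by apply: continuousB; [exact: cst_continuous|exact: tact_continuous].
have : nbhs (0 : E) (tau @^-1` O).
  apply: (ctau 0); rewrite /tau (is_additive0 (tact_additive _)) subr0.
  exact: Og.
rewrite nbhsE => -[B [oB B0] BO].
have nW : nbhs g ((fun x => g^-1 * x)%g @^-1`
    [set h | onset H h /\ B (j (ab_class H h))]).
  apply: (mulgl_continuous (g := g^-1%g)); rewrite mulVg.
  apply: open_nbhs_nbhs; split; first exact: po_ab_open.
  by split; [exact: subgroup1|rewrite /ab_class cls1 /j po_ab1].
apply: filterS nW => x /= [Hx Bx].
have -> : x = (g * (g^-1 * x))%g by rewrite mulgA mulgV mul1g.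
rewrite kapM (kapH Hx) (is_additiveN (tact_additive _)).
exact: (BO _ Bx).
Qed.

(** Continuity of an additive map is tested near 0, hence on the open subgroup [H^ab], whose
    quotient topology reduces it to that of [c]. *)
Lemma hom_continuous (A : topologicalZmodType) (phi : E -> A) (c : G -> A) :
  is_additive phi -> continuous c ->
  (forall h, onset H h -> phi (j (ab_class H h)) = c h) -> continuous phi.
Proof.
move=> phiD cc phij x O /= Ox; pose s (y : A) := phi x + y.
have cs : continuous s.
  by apply: continuousD; [exact: cst_continuous|move=> y; exact: cvg_id].
have : nbhs (0 : A) (s @^-1` O) by apply: (cs 0); rewrite /s addr0; exact: Ox.
rewrite nbhsE => -[B [oB B0] BO].
have oV : open [set j a | a in [set a | B (phi (j a))]].
  apply: ((po_topology E _).2); rewrite /ab_open.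
  rewrite (_ : [set h | _] = onset H `&` c @^-1` B).
    apply: openI; first exact: onset_open.
    by apply: open_comp => // y _; apply: cc.
  by apply/seteqP; split=> h /= [Hh Bh]; split=> //=; rewrite ?phij // -phij.
have nx : nbhs x ((fun y => y - x) @^-1` [set j a | a in [set a | B (phi (j a))]]).
  have cB : continuous (fun y : E => y - x).
    by apply: continuousB; [move=> y; exact: cvg_id|exact: cst_continuous].
  apply: cB; rewrite subrr; apply: open_nbhs_nbhs; split=> //.
  by exists 1%g; rewrite /= /j po_ab1 // (is_additive0 phiD).
apply: filterS nx => y /= [a Ba jay].
have -> : y = x + (y - x) by zmod.
by rewrite -jay /= phiD; apply: BO.
Qed.

Definition iso0 (A : tmod Gam) (phi : {freeg Gam} -> A) (x : 'I_1 -> G) : A :=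
  phi << pcls (x ord0) >>.

Definition iso1 (A : tmod Gam) (phi : E -> A) (x : 'I_2 -> G) : A :=
  phi (kap (x ord_max) - kap (x ord0)).

Lemma proj_ptws_continuous (n : nat) (k : 'I_n) :
  continuous (fun x : {ptws 'I_n -> G} => x k).
Proof. exact: (@proj_continuous 'I_n (fun=> G) k). Qed.

Lemma kap1 : kap 1%g = 0.
Proof.
have := kapM 1%g 1%g; rewrite mulg1 tact_onset; last exact: subgroup1.
by move=> h; zmod1 h.
Qed.

Lemma kap_mull h g : onset H h -> kap (h * g)%g = kap h + kap g.
Proof. by move=> Hh; rewrite kapM tact_onset. Qed.

Section Coefficients.
Variable A : tmod Gam.

(** [D] is kept general so as to serve both for [H] and for [G]. *)
Lemma iso0_cochain D (phi : {freeg Gam} -> A) : is_additive phi ->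
  (forall g z, D g -> phi (zact (pcls g) z) = tact (pcls g) (phi z)) ->
  cts_cochains D 0 A (iso0 phi).
Proof.
move=> phiD phiG; split.
  by move=> g x Dg; rewrite /iso0 /pcls clsM // -zactU phiG.
have cF : continuous (fun g => phi << pcls g >> : A).
  by apply: coset_continuous => g h Hh; rewrite pcls_mulr.
move=> x; apply: (@continuous_comp _ _ _ (fun x : {ptws 'I_1 -> G} => x ord0)
  (fun g => phi << pcls g >> : A)); last exact: cF.
exact: proj_ptws_continuous.
Qed.

Lemma iso0_inj (phi psi : {freeg Gam} -> A) : is_additive phi -> is_additive psi ->
  iso0 phi = iso0 psi -> phi = psi.
Proof.
move=> phiD psiD e; apply/funext; apply: zadd_ext => // k s.
have kU : << k *g s >> = (<< s >> : {freeg Gam}) *~ k by rewrite freegU_mulz intz.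
rewrite kU !is_additiveMz //; congr (_ *~ _).
have := congr1 (fun F => F (fun=> qrepr s)) e.
by rewrite /iso0 /pcls qreprK.
Qed.

Lemma iso0_equivariant (phi : {freeg Gam} -> A) : is_additive phi ->
  @equivariant G (Ginfl A) setT 0 (iso0 phi) ->
  forall s z, phi (zact s z) = tact s (phi z).
Proof.
move=> phiD phieq s; have [g _ ->] := quotE s.
apply: (@zadd_ext _ _ (fun z => phi (zact (pcls g) z))
  (fun z => tact (pcls g) (phi z))).
- by move=> x y; rewrite zactD phiD.
- by move=> x y; rewrite phiD tactD.
move=> k t; have [h _ ->] := quotE t; rewrite zactU.
have kU u : << k *g u >> = (<< u >> : {freeg Gam}) *~ k by rewrite freegU_mulz intz.
rewrite !kU !is_additiveMz //; last exact: tact_additive.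
congr (_ *~ _); have := phieq g (fun=> h) I.
by rewrite /iso0 /pcls clsM.
Qed.

(** [H] acts trivially on [A], so an [H]-equivariant 0-cochain depends only on the class in
    [G/H]. *)
Lemma iso0_surj f : cts_cochains H 0 A f ->
  iso0 (zlin (fun s : Gam => f (fun=> qrepr s))) = f.
Proof.
move=> [feq _]; apply/funext => x; rewrite /iso0 zlin1.
have Hx : onset H (qrepr (pcls (x ord0)) * (x ord0)^-1)%g.
  have := onset_normal (x ord0) (qrepr_cls (s := full_section H) (g := x ord0) I).
  by rewrite !mulgA mulgV mul1g.
have -> : (fun=> qrepr (pcls (x ord0))) =
    (fun k => (qrepr (pcls (x ord0)) * (x ord0)^-1) * x k)%g :> ('I_1 -> G).
  by apply/funext => k; rewrite (ord1 k) mulgVK.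
by rewrite feq //; apply: tact_onset.
Qed.

Lemma iso1_cocycle D (phi : E -> A) : is_additive phi -> continuous phi ->
  (forall g e, D g -> phi (tact (pcls g) e) = tact (pcls g) (phi e)) ->
  cts_cocycles D 1 A (iso1 phi).
Proof.
move=> phiD phic phiG; split; [split|].
- move=> g x Dg; rewrite /iso1 !kapM.
  rewrite (_ : _ - _ = tact (pcls g) (kap (x ord_max) - kap (x ord0))) ?phiG //.
  by rewrite (is_additiveB (tact_additive _)); zmod.
- have ck k : continuous (fun x : {ptws 'I_2 -> G} => kap (x k)).
    move=> x; apply: (@continuous_comp _ _ _ (fun x : {ptws 'I_2 -> G} => x k) kap).
      exact: proj_ptws_continuous.
    exact: cocycle_continuous.
  move=> x; apply: (@continuous_comp _ _ _
    (fun x : {ptws 'I_2 -> G} => kap (x ord_max) - kap (x ord0)) phi).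
    exact: (continuousB (ck _) (ck _)).
  exact: phic.
- move=> x; rewrite (fun3E x) /coboundary_map cobd1E /iso1 !(tnth_nth 1%g) /=.
  by rewrite !(is_additiveB phiD); zmod.
Qed.

Lemma iso1_inj (phi psi : E -> A) : is_additive phi -> is_additive psi ->
  iso1 phi = iso1 psi -> phi = psi.
Proof.
move=> phiD psiD e; apply/funext => x.
have [z <-] := generated_by_cocycle kapH kap_out x.
apply: (@zadd_ext _ _ (phi \o zlin kap) (psi \o zlin kap)).
- by move=> y y'; rewrite /= zlinD phiD.
- by move=> y y'; rewrite /= zlinD psiD.
move=> k g; rewrite /= zlinU !is_additiveMz //; congr (_ *~ _).
have := congr1 (fun F => F (tnth [tuple 1; g]%g)) e.
by rewrite /iso1 !(tnth_nth 1%g) /= kap1 subr0.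
Qed.

Lemma iso1_equivariant (phi : E -> A) : is_additive phi ->
  @equivariant G (Ginfl A) setT 1 (iso1 phi) ->
  forall s e, phi (tact s e) = tact s (phi e).
Proof.
move=> phiD phieq s e; have [g _ ->] := quotE s.
have [z <-] := generated_by_cocycle kapH kap_out e.
apply: (@zadd_ext _ _ (fun z => phi (tact (pcls g) (zlin kap z)))
  (fun z => tact (pcls g) (phi (zlin kap z)))).
- by move=> x y; rewrite zlinD tactD phiD.
- by move=> x y; rewrite zlinD phiD tactD.
move=> k h; rewrite !zlinU !is_additiveMz //; try exact: tact_additive.
congr (_ *~ _); have := phieq g (tnth [tuple 1; h]%g) I.
rewrite /iso1 !(tnth_nth 1%g) /= kap1 subr0 mulg1 kapM => <-.
by congr phi; zmod.
Qed.

Lemma iso_coboundary phi : is_additive phi ->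
  iso1 (phi \o po_out E) = coboundary_map 0 A (iso0 phi).
Proof.
move=> phiD; apply/funext => x; rewrite /coboundary_map cobd0E /iso1 /iso0 /=.
rewrite -(is_additiveB phiD) (is_additiveB (po_out_hom E).1) !kap_out.
by congr phi; zmod.
Qed.

(** The projections separate points, by uniqueness in the limit. Closedness of 0 makes a continuous
    homomorphism from [H] to [A] vanish on the closure of the commutators. *)
Lemma prodiscrete_closed0 : prodiscrete A -> closed [set 0 : A].
Proof.
move=> [S [pr [prh prt pru prn]]] x xcl /=.
have pr0 i : pr i 0 = 0 := is_additive0 (prh i).1.
have prx i : pr i x = 0.
  have nx : nbhs x [set b | pr i b = pr i x] by apply/prn; exists i.
  by have [_ [-> /= <-]] := xcl _ nx.
have [|a [_ au]] := pru (fun=> 0).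
  by move=> i k h; apply: is_additive0 (trans_hom h).1.
by rewrite -(au x prx) (au 0 pr0).
Qed.

(** On [H] the function [c = f(1, -)] is a continuous homomorphism, so it extends through [H^ab] to
    an additive map on [E], which is then corrected by a map factoring through [Z[G/H]]. *)
Lemma iso1_surj f : prodiscrete A -> cts_cocycles H 1 A f ->
  exists2 phi, Hom_Z E A phi & iso1 phi = f.
Proof.
move=> Ap [[feq fc] f0]; pose c g := f (tnth [tuple 1; g]%g).
have fE a b : f (tnth [tuple a; b]) = c b - c a.
  have := f0 (tnth [tuple 1; a; b]%g); rewrite /coboundary_map cobd1E => h.
  by rewrite /c; zmod1 h.
have c1 : c 1%g = 0 by rewrite /c fE subrr.
have cHM h g : onset H h -> c (h * g)%g = c h + c g.
  move=> Hh; have := feq h (tnth [tuple 1; g]%g) Hh.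
  rewrite mul_tnth2 mulg1 fE [RHS]tact_onset // fE c1 => h1.
  by zmod1 h1.
have cc : continuous c.
  move=> g; apply: (@continuous_comp _ _ _
    (fun g => tnth [tuple 1; g]%g : {ptws 'I_2 -> G}) (f : {ptws 'I_2 -> G} -> A)).
    rewrite (_ : (fun g => _) = @dfwith 'I_2 (fun=> G) (fun=> 1%g) ord_max).
      exact: dfwith_continuous.
    apply/funext => x; apply/funext => k.
    case: dfwithP => [|k' ne]; first by rewrite (tnth_nth 1%g).
    by rewrite (tnth_nth 1%g); case: k' ne => -[|[|]].
  exact: fc.
have cD h : closed_derived H h -> c h = 0.
  move=> Dh; have [] := Dh [set x | onset H x /\ c x = 0].
  - rewrite (_ : [set x | _] = onset H `&` c @^-1` [set 0]) //.
    apply: closedI; first exact: open_subgroup_closed (onset_open H).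
    by apply: preimage_closed => [x _|]; [apply: cc|apply: prodiscrete_closed0].
  - split=> [|x y [Hx cx] [Hy cy]|x [Hx cx]].
    + by split=> //; exact: subgroup1.
    + by split; [exact: subgroupM|rewrite cHM // cx cy addr0].
    + split; first exact: subgroupV.
      by have := cHM x x^-1%g Hx; rewrite mulgV c1 cx add0r.
  - move=> x y Hx Hy; rewrite /commg /conjg.
    have HV z : onset H z -> onset H z^-1%g by exact: subgroupV.
    have HM z t : onset H z -> onset H t -> onset H (z * t)%g by exact: subgroupM.
    have cV z : onset H z -> c z^-1%g = - c z.
      by move=> Hz; have := cHM z z^-1%g Hz; rewrite mulgV c1 => h1; zmod1 h1.
    split; first by do ![apply: (HM) => //|apply: (HV) => //].
    by rewrite !cHM ?cV //; [zmod|exact: HV|exact: HV].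
  - by [].
(* The sign compensates [kap h = - j (ab_class H h)]. *)
have [|h Dh|phi0 phi0D phi0j] := extend (A := A) (c := fun g => - c g).
- by move=> h k Hh Hk; rewrite cHM //; zmod.
- by rewrite cD // oppr0.
have phi0k h : onset H h -> phi0 (kap h) = c h.
  by move=> Hh; rewrite kapH // (is_additiveN phi0D) phi0j // opprK.
(* Both [c] and [phi0] composed with [kap] turn left translation by [h] into addition of [c h], so
   their difference depends only on the class in [G/H]. *)
pose d (s : Gam) : A := c (qrepr s) - phi0 (kap (qrepr s)).
have dE g : d (pcls g) = c g - phi0 (kap g).
  pose h := (qrepr (pcls g) * g^-1)%g.
  have Hh : onset H h.
    have := onset_normal g (qrepr_cls (s := full_section H) (g := g) I).
    by rewrite !mulgA mulgV mul1g.
  rewrite /d (_ : qrepr (pcls g) = h * g)%g; last by rewrite /h mulgVK.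
  by rewrite kap_mull // cHM // phi0D phi0k //; zmod.
have d1 : d 1%g = 0.
  by rewrite -(cls1 (full_section H)) dE c1 kap1 (is_additive0 phi0D) subr0.
pose phi x := phi0 x + zlin d (po_out E x).
have phiD : is_additive phi.
  by move=> x y; rewrite /phi phi0D (po_out_hom E).1 zlinD; zmod.
exists phi.
  split=> //; apply: (hom_continuous phiD (c := fun g => - c g)).
    rewrite (_ : (fun g => - c g) = (fun g => 0 - c g)); last first.
      by apply/funext => g; rewrite sub0r.
    by apply: continuousB => //; exact: cst_continuous.
  move=> h Hh; rewrite /phi phi0j // po_out_ab (is_additive0 (zlinD d)).
  by rewrite addr0.
have phik g : phi (kap g) = c g.
  rewrite /phi kap_out (is_additiveB (zlinD d)) !zlin1 d1 dE.
  by zmod.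
apply/funext => x; rewrite /iso1 (is_additiveB phiD) !phik.
by rewrite [in RHS](fun2E x) fE.
Qed.

End Coefficients.
End Complexes.

Lemma fundamental_cocycle (G : topGroupType) (Gp : profinite G)
    (C : class_formation G) (H : open_normal G)
    (X : extension2 (fund C (full_section H)))
    (rec : fixpts C H -> profinite_ab H) (recP : reciprocity rec)
    (E : pushout_module X rec) :
  exists kap : G -> E,
    [/\ forall s t, kap (s * t)%g = kap s + tact (cls (full_section H) s) (kap t),
        forall h, onset H h -> kap h = - po_ab E (ab_class H h),
        forall g, po_out E (kap g) = << cls (full_section H) g >> - << 1%g >>
      & forall (A : zmodType) (c : G -> A),
          (forall h k, onset H h -> onset H k -> c (h * k)%g = c h + c k) ->
          (forall h, closed_derived H h -> c h = 0) ->
          exists2 phi : E -> A, is_additive phi &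
            forall h, onset H h -> phi (po_ab E (ab_class H h)) = c h].
Proof.
have [e [a [b [e_out e1 eM aE]]]] := extension_cocycle X.
have [kap [kapM kapH kap_out]] := cocycle_exists Gp recP E e_out e1 eM aE.
exists kap; split=> // A c; exact: (po_extend Gp recP E e_out e1 eM aE).
Qed.

Theorem theorem5p5 (G : topGroupType) (G_profinite : profinite G)
    (C : class_formation G) (H : open_normal G)
    (X : extension2 (fund C (full_section H)))
    (rec : fixpts C H -> profinite_ab H) (rec_reciprocity : reciprocity rec)
    (E : pushout_module X rec) :
  (* (1) *)
  (exists (F0 : forall A : tmod (quot (full_section H)),
             ({freeg (quot (full_section H))} -> A) -> (('I_1 -> G) -> A))
          (F1 : forall A : tmod (quot (full_section H)),
             (E -> A) -> (('I_2 -> G) -> A)),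
     [/\ forall A, prodiscrete A ->
           complex_iso (HomZring_Z A) (Hom_Z E A) (fun phi => phi \o po_out E)
             (cts_cochains H 0 A) (cts_cocycles H 1 A) (coboundary_map 0 A)
             (F0 A) (F1 A),
         forall A, prodiscrete A -> forall g phi, HomZring_Z A phi ->
           F0 A (conj_act (fun g z => zact (cls (full_section H) g) z) g phi) =
             conj_act (translate 1) g (F0 A phi),
         forall A, prodiscrete A -> forall g phi, Hom_Z E A phi ->
           F1 A (conj_act (fun g e => tact (cls (full_section H) g) e) g phi) =
             conj_act (translate 2) g (F1 A phi),
         natural HomZring_Z F0
       & natural (Hom_Z E) F1])
  /\
  (* (2) *)
  (exists (F0 : forall A : tmod (quot (full_section H)),
             ({freeg (quot (full_section H))} -> A) -> (('I_1 -> G) -> A))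
          (F1 : forall A : tmod (quot (full_section H)),
             (E -> A) -> (('I_2 -> G) -> A)),
     [/\ forall A, prodiscrete A ->
           complex_iso (HomZring_G A) (Hom_G E A) (fun phi => phi \o po_out E)
             (cts_cochains setT 0 A) (cts_cocycles setT 1 A)
             (coboundary_map 0 A) (F0 A) (F1 A),
         natural HomZring_G F0,
         natural (Hom_G E) F1
  (* (3), where F1 E id is the universal element *)
       & forall e : E, exists z : {freeg G},
           zlin (inhomogeneous (F1 E (fun x : E => x))) z = e]).
Proof.
have [kap [kapM kapH kap_out ext]] :=
  fundamental_cocycle G_profinite rec_reciprocity E.
pose F0 (A : tmod (quot (full_section H))) : ({freeg _} -> A) -> ('I_1 -> G) -> A :=
  @iso0 G H A.
pose F1 (A : tmod (quot (full_section H))) : (E -> A) -> ('I_2 -> G) -> A :=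
  @iso1 G C H X rec E kap A.
have kap0 := kap1 kapM.
split.
  exists F0, F1; split.
  - move=> A Ap; split.
    + split=> //; split.
      * move=> phi phiD; apply: iso0_cochain => // g z Hg.
        rewrite tact_onset //; congr phi.
        by rewrite (cls_bot (s := full_section H) Hg) zact1.
      * by move=> phi psi; rewrite !inE => phiD psiD; apply: iso0_inj.
      * move=> f fc; exists (zlin (fun s => f (fun=> qrepr s))).
          exact: zlinD.
        exact: iso0_surj.
    + split=> [|phi psi phiD psiD //]; split.
      * move=> phi [phiD phic]; apply: (iso1_cocycle kapM kapH) => // g z Hg.
        by rewrite !tact_onset.
      * move=> phi psi; rewrite !inE => -[phiD _] [psiD _].
        exact: (iso1_inj kapM kapH kap_out).
      * move=> f fc; have [phi phiH phif] := iso1_surj kapM kapH kap_out ext Ap fc.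
        by exists phi.
    + by move=> phi phiD; apply: (iso_coboundary kap_out).
  - move=> A Ap g phi phiD; apply/funext => x.
    by rewrite /F0 /iso0 /conj_act /translate /= zactU -clsM.
  - move=> A Ap g phi [phiD _]; apply/funext => x.
    rewrite /F1 /iso1 /conj_act /translate /= !kapM.
    congr (tact _ (phi _)); rewrite (is_additiveB (tact_additive _)); zmod.
  - by [].
  - by [].
exists F0, F1; split.
- move=> A Ap; split.
  + split=> //; split.
    * move=> phi [phiD phiG]; apply: iso0_cochain => // g z _; exact: phiG.
    * by move=> phi psi; rewrite !inE => -[phiD _] [psiD _]; apply: iso0_inj.
    * move=> f [feq fc].
      (* A preimage is obtained from part (1); its equivariance is then read off from that of [f],
         and likewise in degree 1, where [kap] generates [E]. *)
      have fH : cts_cochains H 0 A f by split=> // h x _; apply: feq.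
      exists (zlin (fun s => f (fun=> qrepr s))); last exact: iso0_surj.
      split; first exact: zlinD.
      by apply: iso0_equivariant; [exact: zlinD|rewrite iso0_surj].
  + split=> [|phi psi phiD psiD //]; split.
    * move=> phi [[phiD phiG] phic]; apply: (iso1_cocycle kapM kapH) => // g z _.
      exact: phiG.
    * move=> phi psi; rewrite !inE => -[[phiD _] _] [[psiD _] _].
      exact: (iso1_inj kapM kapH kap_out).
    * move=> f [[feq fc] f0].
      have fH : cts_cocycles H 1 A f by do 2!split => //; move=> h x _; apply: feq.
      have [phi [phiD phic] phif] := iso1_surj kapM kapH kap_out ext Ap fH.
      exists phi => //; do 2!split => //.
      by apply: (iso1_equivariant kapM kapH kap_out) => //; rewrite phif.
  + by move=> phi [phiD _]; apply: (iso_coboundary kap_out).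
- by [].
- by [].
(* For the identity of [E] the inhomogeneous cocycle is [kap g - kap 1], that is, [kap] itself. *)
move=> e; have [z <-] := generated_by_cocycle kapH kap_out e; exists z.
congr (zlin _ z); apply/funext => g.
by rewrite /inhomogeneous /F1 /iso1 !(tnth_nth 1%g) /= kap0 subr0.
Qed.
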